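(* Let $X,T,Y,\mathbb F^{Y,T}$ be as defined in the context, and assume that $\beta\neq0$, $|\rho|\neq 1$, and that $J$ is an increasing Lévy process with a nonzero continuous part. Assume that $T_{t_0+h}-T_{t_0}\geq \delta(h)>0$ for any $t_0,h>0$, where $\delta$ is an increasing function with $\delta(0)=0$ and $\delta(h)>0$ for $h>0$. Then $S_t:=S_0e^{\theta Y_t}$ has the no arbitrage property with respect to $\Pi(\mathbb F^{Y,T})$.
   Context: Setting. Let $(\Omega,\mathcal F,\mathbb F,\mathbb P)$ be a filtered probability space, with $\mathbb F=(\mathcal F_t)_{t\ge0}$ satisfying the usual conditions, carrying two independent Brownian motions $B$ and $W$ and an adapted non-decreasing Lévy process $J$ independent of $(B,W)$. For $\rho\in[-1,1]$ let $Z_t:=\rho B_t+\sqrt{1-\rho^2}\,W_t$. Let $\mu,\sigma:[0,\infty)\times\mathbb R\to\mathbb R$ be such that the SDE $$dv_t=\mu(t,v_t)dt+\sigma(t,v_t)dB_t,\quad v_0=1,\qquad dT_t=v_tdt,\quad T_0=0$$ has a unique strong solution, with $v$ nonnegative, $\mathbb E T_t=t$, and $T_t\to\infty$ a.s. as $t\to\infty$. For real constants $\alpha,\beta$, let $X_t:=\alpha J_t+\beta Z_{J_t}$ and $Y_t:=X_{T_t}$. $S_0>0$ and $\theta\in\mathbb R$ are constants. $\mathbb F^{Y,T}$ is the augmented filtration generated by $(Y,T)$. The continuous part of $J$ refers to its Lévy–Itô decomposition: $J$ is the sum of a deterministic linear drift (the continuous part) and a pure jump Lévy process. Trading strategies.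 For a filtration $\mathbb H=(\mathcal H_t)_{t\ge0}$, $\mathcal S(\mathbb H)$ is the set of processes $H=g_0\mathbf 1_{\{0\}}+\sum_{j=1}^{n-1}g_j\mathbf 1_{(\tau_j,\tau_{j+1}]}$ with $n\ge2$, $0\le\tau_1\le\dots\le\tau_n$ $\mathbb H$-stopping times, $\tau_n$ bounded, $g_0$ a real number, and $g_j$ an $\mathcal H_{\tau_j}$-measurable random variable. For $h>0$, $\mathcal S^h(\mathbb H)$ is the subset of those with $\min_j(\tau_{j+1}-\tau_j)\ge h$ a.s., and $\Pi(\mathbb H):=\bigcup_{h>0}\mathcal S^h(\mathbb H)$ (the Cheridito class). For such $H$ and an $\mathbb H$-adapted process $S$, $(H\cdot S)_\infty:=\sum_{j=1}^{n-1}g_j(S_{\tau_{j+1}}-S_{\tau_j})$. No arbitrage. An $\mathbb H$-adapted process $S$ has the no arbitrage property with respect to a class $\mathcal X$ of such strategies if $\{(H\cdot S)_\infty:H\in\mathcal X\}\cap L_0^+=\{0\}$, where $L_0^+$ is the set of nonnegative $\mathcal F$-measurable random variables. *)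

(* Defs.v *)
From HB Require Import structures.
From mathcomp Require Import all_boot all_order all_algebra.
From mathcomp Require Import all_classical all_reals all_analysis.

Set Implicit Arguments.
Unset Strict Implicit.
Unset Printing Implicit Defensive.

Import Order.TTheory GRing.Theory Num.Theory.
Import numFieldNormedType.Exports.

Local Open Scope classical_set_scope.
Local Open Scope ring_scope.

(* Processes and filtrations are indexed by all of R for convenience, but every
   definition below only looks at times t >= 0.  Path properties of given
   processes are only required almost surely. *)

Section sigma_fields.
Context {d : measure_display} {Omega : measurableType d} {R : realType}.
Variable P : probability Omega R.
Implicit Types (G : set (set Omega)) (F : R -> set (set Omega)).
Implicit Types (X Y : R -> Omega -> R).

Definition sigma_rv (V : set (Omega -> R)) : set (set Omega) :=
  <<s [set f @^-1` A | f in V & A in (measurable : set (set R))] >>.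

Definition measurable_wrt G (f : Omega -> R) : Prop :=
  forall A : set R, measurable A -> G (f @^-1` A).

Definition independent G1 G2 : Prop :=
  forall A B, G1 A -> G2 B -> P (A `&` B) = (P A * P B)%E.

Definition past (Xs : set (R -> Omega -> R)) (t : R) : set (set Omega) :=
  sigma_rv [set X s | X in Xs & s in `[0, t]].

Definition whole (Xs : set (R -> Omega -> R)) : set (set Omega) :=
  sigma_rv [set X s | X in Xs & s in `[0, +oo[].

Definition filtration F : Prop :=
  (forall t, 0 <= t -> sigma_algebra setT (F t) /\ F t `<=` measurable) /\
  (forall s t, 0 <= s -> s <= t -> F s `<=` F t).

Definition usual_conditions F : Prop :=
  [/\ filtration F,
      forall t, 0 <= t -> F t = \bigcap_(u in [set u | t < u]) F u
    & P.-negligible `<=` F 0].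

(* The usual augmentation: the smallest filtration satisfying the usual
   conditions to which all the processes of Xs are adapted. *)
Definition augmentation (Xs : set (R -> Omega -> R)) (t : R) :
    set (set Omega) :=
  \bigcap_(u in [set u | t < u]) <<s past Xs u `|` P.-negligible >>.

Definition adapted F X : Prop :=
  forall t, 0 <= t -> measurable_wrt (F t) (X t).

Definition progressively_measurable F X : Prop :=
  forall t, 0 <= t -> forall A : set R, measurable A ->
    <<s [set U `*` C | U in (measurable : set (set R)) & C in F t] >>
      [set z : R * Omega | z.1 \in `[0, t] /\ A (X z.1 z.2)].

Definition stopping_time F (tau : Omega -> R) : Prop :=
  forall t, 0 <= t -> F t [set w | tau w <= t].

Definition stopped_field F (tau : Omega -> R) : set (set Omega) :=
  [set A | measurable A /\
           forall t, 0 <= t -> F t (A `&` [set w | tau w <= t])].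

Definition cvg_in_probability (X : nat -> Omega -> R) (Y : Omega -> R) : Prop :=
  forall e : R, 0 < e ->
    P [set w | e <= `|X k w - Y w|] @[k --> \oo] --> 0%E.

End sigma_fields.

Section processes.
Context {d : measure_display} {Omega : measurableType d} {R : realType}.
Variable P : probability Omega R.
Implicit Types X : R -> Omega -> R.

Definition continuous_paths X : Prop :=
  {ae P, forall w, {within `[0, +oo[, continuous (X^~ w)}}.

Definition nondecreasing_paths X : Prop :=
  {ae P, forall w s t, 0 <= s -> s <= t -> X s w <= X t w}.

Definition cadlag_paths X : Prop :=
  {ae P, forall w,
    (forall t, 0 <= t -> X u w @[u --> t^'+] --> X t w) /\
    (forall t, 0 < t -> cvg (X u w @[u --> t^'-]))}.

Definition independent_increments X : Prop :=
  forall s t, 0 <= s -> s <= t ->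
    independent P (sigma_rv [set X t \- X s]) (past [set X] s).

Definition brownian_motion X : Prop :=
  [/\ forall t, 0 <= t -> measurable_fun setT (X t),
      {ae P, forall w, X 0 w = 0},
      independent_increments X,
      forall s t, 0 <= s -> s < t -> forall A : set R, measurable A ->
        pushforward P (X t \- X s) A = normal_prob 0 (Num.sqrt (t - s)) A
    & continuous_paths X].

Definition levy_process X : Prop :=
  [/\ forall t, 0 <= t -> measurable_fun setT (X t),
      {ae P, forall w, X 0 w = 0},
      independent_increments X,
      forall s t, 0 <= s -> s <= t -> forall A : set R, measurable A ->
        pushforward P (X t \- X s) A = pushforward P (X (t - s)) A
    & cadlag_paths X].

Definition jump X (s : R) (w : Omega) : R := X s w - lim (X u w @[u --> s^'-]).

(* Only meant for processes with nonnegative jumps: \esum is the supremum of the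
   finite partial sums. *)
Definition pure_jump X : Prop :=
  {ae P, forall w t, 0 <= t ->
    (X t w)%:E = \esum_(s in `]0, t]) (jump X s w)%:E}.

(* Levy-Ito decomposition of a non-decreasing Levy process J: its jumps are
   nonnegative and summable, and no compensation is needed. *)
Definition nonzero_continuous_part (J : R -> Omega -> R) : Prop :=
  exists b : R, exists L : R -> Omega -> R,
    [/\ b != 0, levy_process L, pure_jump L
      & {ae P, forall w t, 0 <= t -> J t w = b * t + L t w}].

End processes.

Section stochastic_integral.
Context {d : measure_display} {Omega : measurableType d} {R : realType}.
Variable P : probability Omega R.
Implicit Types (F : R -> set (set Omega)) (H B M v : R -> Omega -> R).

(* The integrand \sum_(i < n) c_i 1_(t_i, t_(i+1)]. *)
Record elementary := Elementary {
  el_size : nat;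
  el_time : nat -> R;
  el_coef : nat -> Omega -> R }.

Definition elementary_integrand F (K : elementary) : Prop :=
  [/\ 0 <= el_time K 0%N,
      forall i, el_time K i <= el_time K i.+1
    & forall i, (i < el_size K)%N ->
        measurable_wrt (F (el_time K i)) (el_coef K i) /\
        exists C : R, forall w, `|el_coef K i w| <= C].

Definition elementary_process (K : elementary) (s : R) (w : Omega) : R :=
  \sum_(i < el_size K)
    el_coef K i w * \1_(`]el_time K i, el_time K i.+1]) s.

Definition elementary_integral (K : elementary) B (t : R) (w : Omega) : R :=
  \sum_(i < el_size K)
    el_coef K i w * (B (Num.min (el_time K i.+1) t) w
                     - B (Num.min (el_time K i) t) w).

(* M = \int_0^. H dB, where B is a Brownian motion in the filtration F. *)
Definition ito_integral F B H M : Prop :=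
  [/\ progressively_measurable F H,
      {ae P, forall w t, 0 <= t ->
        lebesgue_measure.-integrable `[0, t] (fun s => ((H s w) ^+ 2)%:E)},
      adapted F M,
      continuous_paths P M
    & exists K : nat -> elementary,
        (forall k, elementary_integrand F (K k)) /\
        forall t, 0 <= t ->
          cvg_in_probability P
            (fun k w => \int[lebesgue_measure]_(s in `[0, t])
               (elementary_process (K k) s w - H s w) ^+ 2) (fun=> 0) /\
          cvg_in_probability P
            (fun k => elementary_integral (K k) B t) (M t)].

(* Strong solution of dv_t = mu(t, v_t) dt + sigma(t, v_t) dB_t, v_0 = x0. *)
Definition strong_solution (mu sigma : R -> R -> R) (x0 : R) B v : Prop :=
  let F := augmentation P [set B] in
  [/\ adapted F v,
      continuous_paths P v,
      progressively_measurable F (fun s w => mu s (v s w)),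
      {ae P, forall w t, 0 <= t ->
        lebesgue_measure.-integrable `[0, t] (fun s => (mu s (v s w))%:E)}
    & exists M, ito_integral F B (fun s w => sigma s (v s w)) M /\
        {ae P, forall w t, 0 <= t ->
          v t w = x0 + \int[lebesgue_measure]_(s in `[0, t]) mu s (v s w)
                  + M t w}].

Definition unique_strong_solution (mu sigma : R -> R -> R) (x0 : R) B v : Prop :=
  strong_solution mu sigma x0 B v /\
  forall v', strong_solution mu sigma x0 B v' ->
    {ae P, forall w t, 0 <= t -> v' t w = v t w}.

Definition time_change v (t : R) (w : Omega) : R :=
  \int[lebesgue_measure]_(s in `[0, t]) v s w.

End stochastic_integral.

Section trading.
Context {d : measure_display} {Omega : measurableType d} {R : realType}.
Variable P : probability Omega R.
Implicit Types (F : R -> set (set Omega)) (S : R -> Omega -> R).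

(* g_0 1_{0} + \sum_(1 <= j < n) g_j 1_(tau_j, tau_(j+1)] is given by the
   data (n, g_0, g, tau); g j and tau j are only relevant for 1 <= j < n and
   1 <= j <= n respectively. *)
Record strategy := Strategy {
  st_size : nat;
  st_init : R;
  st_pos : nat -> Omega -> R;
  st_time : nat -> Omega -> R }.

Definition simple_strategy F : set strategy := [set H |
  [/\ (2 <= st_size H)%N,
      forall w, 0 <= st_time H 1 w,
      forall j w, (1 <= j < st_size H)%N -> st_time H j w <= st_time H j.+1 w,
      forall j, (1 <= j <= st_size H)%N -> stopping_time F (st_time H j)
    & (exists N : R, forall w, st_time H (st_size H) w <= N) /\
      forall j, (1 <= j < st_size H)%N ->
        measurable_wrt (stopped_field F (st_time H j)) (st_pos H j)]].

Definition simple_strategy_wait F (h : R) : set strategy :=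
  simple_strategy F `&` [set H |
    {ae P, forall w j, (1 <= j < st_size H)%N ->
      h <= st_time H j.+1 w - st_time H j w}].

Definition cheridito_class F : set strategy :=
  \bigcup_(h in [set h : R | 0 < h]) simple_strategy_wait F h.

Definition terminal_gain (H : strategy) S (w : Omega) : R :=
  \sum_(1 <= j < st_size H)
    st_pos H j w * (S (st_time H j.+1 w) w - S (st_time H j w) w).

Definition L0_plus : set (Omega -> R) :=
  [set x : Omega -> R | measurable_fun setT x /\ {ae P, forall w, 0 <= x w}].

(* Random variables are identified when almost surely equal, so both sides are
   saturated for that relation. *)
Definition no_arbitrage F (XX : set strategy) S : Prop :=
  adapted F S /\
  [set x : Omega -> R |
     exists2 H, XX H & {ae P, forall w, x w = terminal_gain H S w}] `&` L0_plus
  = [set x : Omega -> R | measurable_fun setT x /\ {ae P, forall w, x w = 0}].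

End trading.

(* Main.v *)
Require Import Defs.
From mathcomp Require Import all_boot all_order all_algebra.
From mathcomp Require Import all_classical all_reals all_analysis.
From mathcomp Require Import measurable_realfun lra ring.
Import Order.TTheory GRing.Theory Num.Theory.
Import numFieldNormedType.Exports.
Set Implicit Arguments.
Unset Strict Implicit.
Unset Printing Implicit Defensive.
Local Open Scope classical_set_scope.
Local Open Scope ring_scope.

(** With C_t = J_{T_t}, the log-price is
    Y_t = alpha C_t + beta rho B_{C_t} + c W_{C_t}, c = beta sqrt(1 - rho^2) <> 0,
    where (C, T) depends on (B, J) only and is therefore independent of W.  Since
    J has a positive drift b and T grows by at least delta(h) over a time h, the
    clock C advances by at least b delta(h) over a time h.  Hence, given the past
    up to time q, the increments of W may carry Y beyond any level, upwards or
    downwards, and keep it there during the whole time interval [q + h, N], with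
    positive probability.

    Let a strategy with waiting time h have a nonnegative gain, and consider the
    first trade whose position is not almost surely zero.  Steering Y against the
    sign of the position at this trade and at each of the following ones produces
    an event of positive probability on which the gain is negative.  Hence all
    positions vanish. *)

(** * Sigma-fields and independence *)

(** No conditional law and no strong Markov property is used. Their substitute is that an event of
    positive probability meets some member of a countable, almost sure cover with positive
    probability; this turns a random bound into an integer, and a stopping time or the clock into a
    cell of a grid. The main obstacle is that two scales of time coexist: [(Y, T)] up to a calendar
    time [p] involves [W] up to the random level [C p], while the increments of [W] are independent
    of the past at deterministic levels. The remedy is to work on [[C p < r]] and to enlarge the
    past of [W] at level [r] by all of [(B, J)], future included: the whole clock and all of [B] are
    then known, and the increments of [W] after [r] stay independent of this information. Positions
    have no bound, so gains of different trades cannot be compared in size. Since the exponential is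
    monotone, signs suffice: one trade loses strictly, and no later one gains. The waiting time
    leaves room between two trades to move [Y], even though the start of a trade is only located up
    to [h / 4]. *)

Section sigma_algebras.
Context {T : pointedType}.
Implicit Types (G H : set (set T)) (A B : set T).

(** Through this identity the closure lemmas about [measurable] apply to a bare set of sets. *)
Lemma sigma_algebra_measurableE G :
  sigma_algebra setT G -> @measurable _ (g_sigma_algebraType G) = G.
Proof. exact: measurable_g_measurableTypeE. Qed.

Lemma sigma_algebra_setT G : sigma_algebra setT G -> G setT.
Proof.
move=> sG; rewrite -(sigma_algebra_measurableE sG).
exact: (@measurableT _ (g_sigma_algebraType G)).
Qed.

Lemma sigma_algebra_setC G A : sigma_algebra setT G -> G A -> G (~` A).
Proof.
move=> sG; rewrite -(sigma_algebra_measurableE sG).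
exact: (@measurableC _ (g_sigma_algebraType G)).
Qed.

Lemma sigma_algebra_setI G A B :
  sigma_algebra setT G -> G A -> G B -> G (A `&` B).
Proof.
move=> sG; rewrite -(sigma_algebra_measurableE sG).
exact: (@measurableI _ (g_sigma_algebraType G)).
Qed.

Lemma sigma_algebra_setU G A B :
  sigma_algebra setT G -> G A -> G B -> G (A `|` B).
Proof.
move=> sG; rewrite -(sigma_algebra_measurableE sG).
exact: (@measurableU _ (g_sigma_algebraType G)).
Qed.

Lemma sigma_algebra_setD G A B :
  sigma_algebra setT G -> G A -> G B -> G (A `\` B).
Proof.
move=> sG; rewrite -(sigma_algebra_measurableE sG).
exact: (@measurableD _ (g_sigma_algebraType G)).
Qed.

(** The guard [D] serves to restrict rational times to an interval, or grid indices to a range. *)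
Lemma sigma_algebra_countable_forall G (I : countType) (D : I -> Prop)
    (E : I -> set T) : sigma_algebra setT G -> (forall i, D i -> G (E i)) ->
  G [set w | forall i, D i -> E i w].
Proof.
move=> sG GE; rewrite [X in G X](_ : _ =
  ~` \bigcup_n oapp (fun i => [set w | D i /\ ~ E i w]) set0 (unpickle n)).
  apply: sigma_algebra_setC => //; case: (sG) => G0 _ GU; apply: GU => n.
  case: unpickle => [i|//] /=; have [Di|nDi] := pselect (D i).
    rewrite [X in G X](_ : _ = ~` E i).
      by apply: sigma_algebra_setC => //; exact: GE.
    by apply/seteqP; split => [w []//|w].
  by rewrite [X in G X](_ : _ = set0)//; apply/seteqP; split => w // [].
apply/seteqP; split => [w h [n _]|w h i Di].
  by case: unpickle => [i [Di]|//]; apply; exact: h.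
by apply: contrapT => nE; apply: h; exists (pickle i) => //; rewrite pickleK.
Qed.

Lemma g_sigma_algebraP G : sigma_algebra setT <<s G>>.
Proof. exact: smallest_sigma_algebra. Qed.

Lemma g_sigma_algebra_subset G H :
  sigma_algebra setT H -> G `<=` H -> <<s G >> `<=` H.
Proof. exact: smallest_sub. Qed.

End sigma_algebras.

Section independence.
Context {d : measure_display} {Omega : measurableType d} {R : realType}.
Variable P : probability Omega R.
Implicit Types (G H : set (set Omega)) (A B : set Omega).

Lemma independent_sym G H : independent P G H -> independent P H G.
Proof. by move=> i A B HA GB; rewrite setIC i// muleC. Qed.

Lemma independentS G G' H H' : G' `<=` G -> H' `<=` H ->
  independent P G H -> independent P G' H'.
Proof. by move=> sG sH i A B /sG ? /sH ?; exact: i. Qed.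

(** For fixed [B] in [H], the finite measures [A |-> P (A & B)] and [A |-> P B * P A] agree on the
    pi-system [G], which contains the whole space, hence on the sigma-field it generates. *)
Lemma independent_generated G H :
  G `<=` measurable -> H `<=` measurable -> setI_closed G -> G setT ->
  independent P H G -> independent P H <<s G >>.
Proof.
move=> mG mH IG GT i B A HB sA; have mB := mH _ HB.
have PB0 : 0 <= fine (P B) by exact: fine_ge0.
pose m1 : {measure set Omega -> \bar R} := mrestr P mB.
pose m2 : {measure set Omega -> \bar R} := mscale (NngNum PB0) P.
have PBE : (fine (P B))%:E = P B by rewrite fineK// fin_num_measure.
have <- : m2 A = (P B * P A)%E by rewrite /m2/= /mscale/= PBE.
have <- : m1 A = P (B `&` A) by rewrite /m1/= /mrestr setIC.
apply: (g_sigma_algebra_measure_unique G mG (fun=> setT)) => //.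
- by rewrite bigcup_const//; exists 0%N.
- by move=> C GC; rewrite /m1/= /mrestr /m2/= /mscale/= PBE setIC i.
- by move=> _; rewrite /m1/= /mrestr setTI (le_lt_trans (probability_le1 P mB))// ltry.
Qed.

(** The intersections of a member of [G2] with a member of [G3] form a pi-system generating the
    join. Pairwise independence would not do: an event of [G3] has to be independent of [A & B]
    jointly. *)
Lemma independent_join G1 G2 G3 :
  sigma_algebra setT G1 -> G1 `<=` measurable ->
  G2 `<=` measurable -> setI_closed G2 -> G2 setT ->
  G3 `<=` measurable -> setI_closed G3 -> G3 setT ->
  independent P G1 G2 ->
  (forall A B C, G1 A -> G2 B -> G3 C ->
    P (A `&` B `&` C) = (P (A `&` B) * P C)%E) ->
  independent P G1 <<s G2 `|` G3 >>.
Proof.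
move=> sG1 mG1 mG2 IG2 G2T mG3 IG3 G3T i12 i123.
pose K := [set B `&` C | B in G2 & C in G3].
have mK : K `<=` measurable.
  by move=> _ [B GB [C GC <-]]; apply: measurableI; [exact: mG2|exact: mG3].
apply: (@independentS G1 G1 <<s K >>) => //.
  apply: g_sigma_algebra_subset; first exact: g_sigma_algebraP.
  move=> B [GB|GB]; apply: sub_sigma_algebra.
    by exists B => //; exists setT => //; rewrite setIT.
  by exists setT => //; exists B => //; rewrite setTI.
apply: independent_generated => //.
- move=> _ _ [B GB [C GC <-]] [B' GB' [C' GC' <-]].
  exists (B `&` B'); first exact: IG2.
  by exists (C `&` C'); [exact: IG3|rewrite setIACA].
- by exists setT => //; exists setT => //; rewrite setIT.
- move=> A _ GA [B GB [C GC <-]]; rewrite setIA i123// i12// -muleA.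
  congr (_ * _)%E; rewrite -[B]setTI i123 ?setTI//.
  exact: sigma_algebra_setT.
Qed.

Lemma independent_negligible G H :
  P.-negligible `<=` measurable -> sigma_algebra setT G -> G `<=` measurable ->
  H `<=` measurable -> setI_closed H -> H setT ->
  independent P G H -> independent P G <<s H `|` P.-negligible >>.
Proof.
move=> mN sG mG mH IH HT i.
apply: (@independentS G G <<s H `|` (P.-negligible `|` [set setT])>>) => //.
  by apply: sub_sigma_algebra2; apply: setUS; exact: subsetUl.
have PN A : P.-negligible A -> P A = 0%E.
  by move=> NA; exact/negligibleP/NA/mN.
apply: independent_join => //.
- by move=> A [/mN//|->]; exact: measurableT.
- move=> A B [NA|->]; last by rewrite setTI.
  by move=> _; left; apply: negligibleS NA; exact: subIsetl.
- by right.
- move=> A B C GA HB [NC|->]; last by rewrite setIT probability_setT mule1.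
  by rewrite (PN C)// (PN (_ `&` _)) ?mule0//; apply: negligibleS NC; exact: subIsetr.
Qed.

End independence.

(** * Events of positive probability *)

Section almost_sure.
Context {d : measure_display} {Omega : measurableType d} {R : realType}.
Variable P : probability Omega R.
Implicit Types (G H : set (set Omega)) (A B : set Omega).

(** Otherwise [A] would lie in a countable union of null sets. This is the localisation tool of the
    whole proof. *)
Lemma probability_gt0_exists (I : countType) A (E : I -> set Omega) :
  measurable A -> (forall i, measurable (E i)) ->
  {ae P, forall w, A w -> exists i, E i w} ->
  (0 < P A)%E -> exists i, (0 < P (A `&` E i))%E.
Proof.
move=> mA mE AE PA; apply: contrapT => /forallNP h.
have NE i : P.-negligible (A `&` E i).
  apply/negligibleP; first exact: measurableI.
  by apply/eqP; have /negP := h i; rewrite lt_neqAle measure_ge0 andbT negbK eq_sym.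
suff: P.-negligible A by move/negligibleP => /(_ mA) PA0; rewrite PA0 ltxx in PA.
apply: (@negligibleS _ _ _ _ (~` [set w | A w -> exists i, E i w] `|`
  \bigcup_n oapp (fun i => A `&` E i) set0 (unpickle n))).
  move=> w Aw; have [h'|h'] := pselect (exists i, E i w); last by left => /(_ Aw).
  by case: h' => i Ei; right; exists (pickle i) => //; rewrite pickleK.
apply: negligibleU => //; apply: negligible_bigcup => n.
by case: unpickle => [i|] /=; [exact: NE|exact: negligible_set0].
Qed.

Lemma probability_gt0_ae A (E : set Omega) :
  measurable A -> measurable E -> {ae P, forall w, A w -> E w} ->
  (0 < P A)%E -> (0 < P E)%E.
Proof.
move=> mA mE AE PA.
have [|//|[] h] := @probability_gt0_exists unit A (fun=> E) mA _ _ PA => //.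
  by apply: filterS AE => w AEw /AEw; exists tt.
by apply: lt_le_trans h _; apply: le_measure; rewrite ?inE//; exact: measurableI.
Qed.

Lemma probability_gt0_witness A (Q : Omega -> Prop) :
  measurable A -> (0 < P A)%E -> {ae P, forall w, Q w} -> exists2 w, A w & Q w.
Proof.
move=> mA PA QA; apply: contrapT => h.
suff: P.-negligible A by move/negligibleP => /(_ mA) PA0; rewrite PA0 ltxx in PA.
by apply: negligibleS QA => w Aw /= Qw; apply: h; exists w.
Qed.

End almost_sure.

(** * Right-continuous paths and random time sampling *)

Section paths.
Context {R : realType}.
Implicit Types (f g : R -> R) (t : R).

(** Allowing [u = t] makes the notion stable under composition with a nondecreasing function, which
    may be flat to the right of [t]. *)
Definition right_continuous_at f t : Prop :=
  forall e, 0 < e -> exists2 D, 0 < D &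
    forall u, t <= u -> u < t + D -> `|f u - f t| < e.

Lemma right_continuous_at_comp f g t : {in `[0, +oo[ &, nondecreasing f} ->
  0 <= t -> right_continuous_at f t -> right_continuous_at g (f t) ->
  right_continuous_at (g \o f) t.
Proof.
move=> ndf t0 cf cg e /cg[D D0 hD]; have [D' D'0 hD'] := cf _ D0.
exists D' => // u tu uD /=; apply: hD.
  by apply: ndf => //; rewrite in_itv/= ?t0// (le_trans t0).
by have := hD' _ tu uD; rewrite ltr_distl addrC => /andP[].
Qed.

Lemma right_continuous_atD f g t : right_continuous_at f t ->
  right_continuous_at g t -> right_continuous_at (fun s => f s + g s) t.
Proof.
move=> cf cg e e0; have e20 : 0 < e / 2 by rewrite divr_gt0.
have [D D0 hD] := cf _ e20; have [D' D'0 hD'] := cg _ e20.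
exists (Num.min D D'); first by rewrite lt_min D0.
move=> u tu; rewrite -ltrBlDl lt_min !ltrBlDl => /andP[uD uD'].
rewrite opprD addrACA (le_lt_trans (ler_normD _ _))// [ltRHS](splitr e).
by apply: ltrD; [exact: hD|exact: hD'].
Qed.

Lemma right_continuous_atM (k : R) f t : right_continuous_at f t ->
  right_continuous_at (fun s => k * f s) t.
Proof.
move=> cf e e0.
have e'0 : 0 < e / (`|k| + 1) by rewrite divr_gt0// ltr_wpDl.
have [D D0 hD] := cf _ e'0; exists D => // u tu uD.
rewrite -mulrBr normrM; have := hD _ tu uD; rewrite ltr_pdivlMr ?ltr_wpDl//.
apply: le_lt_trans; rewrite mulrC ler_wpM2l// lerDl//.
Qed.

Lemma continuous_withinP (A : set R) f : {within A, continuous f} ->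
  forall t e, A t -> 0 < e -> exists2 D, 0 < D &
    forall u, A u -> `|u - t| < D -> `|f u - f t| < e.
Proof.
move=> cf t e At e0.
have : f u @[u --> within A (nbhs t)] --> f t.
  by rewrite (nbhs_subspace_in At); exact: cf.
move=> /cvgrPdist_lt/(_ _ e0)[D /= D0 hD].
exists D => // u Au uD; rewrite distrC; apply: (hD u) => //.
by rewrite /= distrC.
Qed.

Lemma continuous_halflineP f : {within `[0, +oo[, continuous f} ->
  forall t e, 0 <= t -> 0 < e -> exists2 D, 0 < D &
    forall u, 0 <= u -> `|u - t| < D -> `|f u - f t| < e.
Proof.
move=> cf t e t0 e0.
have [|D D0 hD] := @continuous_withinP _ _ cf t e _ e0.
  by rewrite /= in_itv/= t0.
by exists D => // u u0; apply: hD; rewrite /= in_itv/= u0.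
Qed.

Lemma continuous_right_continuous_at f t : {within `[0, +oo[, continuous f} ->
  0 <= t -> right_continuous_at f t.
Proof.
move=> cf t0 e e0; have [D D0 hD] := continuous_halflineP cf t0 e0.
exists D => // u tu uD; apply: hD; first exact: le_trans tu.
by rewrite ger0_norm ?subr_ge0// ltrBlDl.
Qed.

Lemma cvg_right_continuous_at f t : f u @[u --> t^'+] --> f t ->
  right_continuous_at f t.
Proof.
move=> cf e e0; have /cvgrPdist_lt/(_ _ e0)[D /= D0 hD] := cf.
exists D => // u; rewrite le_eqVlt => /predU1P[->|tu] uD; first by rewrite subrr normr0.
by rewrite distrC; apply: hD => //=; rewrite distrC gtr0_norm ?subr_gt0// ltrBlDl.
Qed.

(** The bound is a natural number so that it can index a countable cover. *)
Lemma continuous_segment_bounded f (N : R) :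
  {within `[0, +oo[, continuous f} ->
  exists n : nat, forall t, 0 <= t -> t <= N -> `|f t| <= n%:R.
Proof.
move=> cf; have [N0|N0] := leP 0 N; last first.
  by exists 0%N => t t0 tN; have := le_trans t0 tN; rewrite leNgt N0.
have cf' : {within `[0, N], continuous f}.
  apply: continuous_subspaceW cf => x /=; rewrite !in_itv/= => /andP[->//].
have [c _ cmax] := EVT_max N0 cf'; have [c' _ cmin] := EVT_min N0 cf'.
exists (Num.truncn (`|f c| + `|f c'|)).+1 => t t0 tN.
have tI : t \in `[0, N] by rewrite in_itv/= t0.
apply: le_trans (ltW (truncnS_gt _)).
have := cmax _ tI; have := cmin _ tI; have := ler_norm (f c).
have := ler_norm (- f c'); have := ler_norm (f c'); rewrite normrN.
have := normr_ge0 (f c); have := normr_ge0 (f c').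
by move=> *; rewrite ler_norml; apply/andP; split; lra.
Qed.

Lemma rat_between (a b : R) : a < b -> exists q : rat, a < ratr q < b.
Proof.
move=> /rat_in_itvoo[q]; rewrite in_itv/= => ?; by exists q.
Qed.

(** Rational times just to the right of [t] are still below [b]. Constraints on paths can thus be
    stated over countably many times and yet apply at a stopping time. *)
Lemma right_continuous_le_rat f (a b k t : R) :
  right_continuous_at f t -> a <= t -> t < b ->
  (forall q : rat, a <= ratr q < b -> f (ratr q) <= k) -> f t <= k.
Proof.
move=> cf at_ tb h; apply/ler_addgt0Pr => e /cf[D D0 hD].
have [|q /andP[tq]] := @rat_between t (Num.min b (t + D)).
  by rewrite lt_min tb ltrDl.
rewrite lt_min => /andP[qb qD]; have := hD _ (ltW tq) qD.
have : f (ratr q) <= k by apply: h; rewrite qb (le_trans at_ (ltW tq)).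
rewrite ltr_norml => ? /andP[? ?]; lra.
Qed.

End paths.

(** * Measurability of sampled processes and of the time change *)

Section measurability.
Context {d : measure_display} {Omega : measurableType d} {R : realType}.
Variable P : probability Omega R.
Implicit Types (G H : set (set Omega)) (f g : Omega -> R).

Lemma measurable_wrtP G f : sigma_algebra setT G ->
  measurable_wrt G f <-> measurable_fun setT (f : g_sigma_algebraType G -> R).
Proof.
move=> sG; split => [mf _ A mA|mf A mA].
  by rewrite setTI (sigma_algebra_measurableE sG); exact: mf.
by have := mf measurableT A mA; rewrite setTI (sigma_algebra_measurableE sG).
Qed.

Lemma measurable_wrtS G H f : G `<=` H -> measurable_wrt G f -> measurable_wrt H f.
Proof. by move=> GH mf A /mf /GH. Qed.

Lemma measurable_wrt_ae G f g : sigma_algebra setT G -> P.-negligible `<=` G ->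
  {ae P, forall w, f w = g w} -> measurable_wrt G f -> measurable_wrt G g.
Proof.
move=> sG NG fg mf A mA.
rewrite [X in G X](_ : _ = (f @^-1` A `&` [set w | f w = g w]) `|`
  (g @^-1` A `&` ~` [set w | f w = g w])).
  apply: sigma_algebra_setU => //.
    apply: sigma_algebra_setI => //; first exact: mf.
    by rewrite -[X in G X]setCK; apply: sigma_algebra_setC => //; exact: NG.
  by apply: NG; apply: negligibleS fg; exact: subIsetr.
apply/seteqP; split => w /=.
  by have [fgw|] := pselect (f w = g w); [left; rewrite fgw|right].
by case => [[+ <-]|[]].
Qed.

(** The time [tau] is approximated from the right by the next point of the grid of mesh
    [1 / (n + 1)], where sampling only involves countably many fixed times; right continuity gives
    the limit. *)
Lemma measurable_sampling d' (T : measurableType d') (X : R -> T -> R)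
    (tau : T -> R) :
  (forall t, 0 <= t -> measurable_fun setT (X t)) ->
  (forall w t, 0 <= t -> right_continuous_at (X^~ w) t) ->
  measurable_fun setT tau -> (forall w, 0 <= tau w) ->
  measurable_fun setT (fun w => X (tau w) w).
Proof.
move=> mX cX mtau tau0.
pose K n w := Num.truncn (n.+1%:R * tau w).
pose h n w := X ((K n w).+1%:R / n.+1%:R) w.
have Kitv n w : (K n w)%:R / n.+1%:R <= tau w < (K n w).+1%:R / n.+1%:R.
  rewrite ler_pdivrMr// ltr_pdivlMr// mulrC.
  by apply: truncn_itv; rewrite mulr_ge0.
apply: (@measurable_fun_cvg _ _ _ _ h) => [n _ A mA|w _].
  rewrite setTI [X in measurable X](_ : _ = \bigcup_k
    ([set w | k%:R / n.+1%:R <= tau w < k.+1%:R / n.+1%:R] `&`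
     X (k.+1%:R / n.+1%:R) @^-1` A)); last first.
    apply/seteqP; split => [w hA|w [k _ [kw XA]]].
      by exists (K n w) => //; split => //=; exact: Kitv.
    rewrite /preimage/= /h (_ : K n w = k)//.
    apply: truncn_def; rewrite mulrC -ler_pdivrMr// -ltr_pdivlMr//.
  apply: bigcup_measurable => k _; apply: measurableI.
    have := mtau measurableT `[k%:R / n.+1%:R, k.+1%:R / n.+1%:R[%classic
       (measurable_itv _).
    rewrite setTI; congr measurable; apply/seteqP; split => w /=; by rewrite in_itv.
  rewrite -[X in measurable X]setTI; apply: mX => //; exact: divr_ge0.
apply/cvgrPdist_lt => e e0.
have [D D0 hD] := cX w _ (tau0 w) _ e0.
near=> n; rewrite distrC; apply: hD.
  by have /andP[_ /ltW] := Kitv n w.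
have /andP[+ _] := Kitv n w; rewrite -[(K n w).+1%:R]natr1 mulrDl mul1r => Kle.
apply: le_lt_trans (lerD Kle (lexx _)) _; rewrite ltrD2l.
by near: n; exact: near_infty_natSinv_lt (PosNum D0).
Unshelve. all: by end_near. Qed.

Lemma measurable_wrt_sampling H (X : R -> Omega -> R) (tau : Omega -> R) :
  sigma_algebra setT H -> P.-negligible `<=` H ->
  (forall t, 0 <= t -> measurable_wrt H (X t)) ->
  {ae P, forall w t, 0 <= t -> right_continuous_at (X^~ w) t} ->
  measurable_wrt H tau -> {ae P, forall w, 0 <= tau w} ->
  measurable_wrt H (fun w => X (tau w) w).
Proof.
move=> sH NH mX cX mtau tau0.
(* Paths are regular only almost surely, so [X] and [tau] are set to zero off [good]; completeness
   of [H] makes the change harmless. *)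
pose good := [set w | (forall t, 0 <= t -> right_continuous_at (X^~ w) t) /\ 0 <= tau w].
have goodP : {ae P, forall w, good w} by apply: (filterS2 _ _ cX tau0) => w ? ?; split.
pose X' t w := if pselect (good w) then X t w else 0.
pose tau' w := if pselect (good w) then tau w else 0.
apply: (@measurable_wrt_ae _ (fun w => X' (tau' w) w)) => //.
  by apply: filterS goodP => w gw; rewrite /X' /tau'; case: pselect.
apply/measurable_wrtP => //; apply: (@measurable_sampling _ (g_sigma_algebraType H) X' tau').
- move=> t t0; apply/measurable_wrtP => //; apply: measurable_wrt_ae (mX t t0) => //.
  by apply: filterS goodP => w gw; rewrite /X'; case: pselect.
- move=> w t t0; rewrite /X'; case: pselect => [gw|ngw] /=; first exact: gw.1.
  by move=> e e0; exists 1 => // u _ _; rewrite subrr normr0.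
- apply/measurable_wrtP => //; apply: measurable_wrt_ae mtau => //.
  by apply: filterS goodP => w gw; rewrite /tau'; case: pselect.
- by move=> w; rewrite /tau'; case: pselect => // gw; exact: gw.2.
Qed.

Lemma measurable_wrt_time_change H (v : R -> Omega -> R) (s : R) :
  sigma_algebra setT H -> P.-negligible `<=` H ->
  (forall t, 0 <= t -> measurable_wrt H (v t)) ->
  continuous_paths P v -> {ae P, forall w t, 0 <= t -> 0 <= v t w} ->
  measurable_wrt H (time_change v s).
Proof.
move=> sH NH mv cv v0.
pose good := [set w | {within `[0, +oo[, continuous (v^~ w)} /\
  forall t, 0 <= t -> 0 <= v t w].
have goodP : {ae P, forall w, good w} by apply: (filterS2 _ _ cv v0) => w ? ?; split.
pose v' t w := if pselect (good w) then v t w else 0.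
have v'0 t w : 0 <= t -> 0 <= v' t w.
  by move=> t0; rewrite /v'; case: pselect => // gw; exact: gw.2.
apply: (@measurable_wrt_ae _ (time_change v' s)) => //.
  by apply: filterS goodP => w gw; rewrite /time_change /v'; case: pselect.
apply/measurable_wrtP => //; pose S := g_sigma_algebraType H.
pose f (z : S * R) := v' (Num.max z.2 0) z.1.
have mf : measurable_fun setT f.
  (* Joint measurability of [v'] is sampling on the product space, the second coordinate being the
     random time; Tonelli then makes the integral measurable. *)
  apply: (@measurable_sampling _ (S * R)%type (fun t z => v' t z.1)
    (fun z => Num.max z.2 0)).
  - move=> t t0; apply: (@measurableT_comp _ _ _ _ _ _ (v' t : S -> R)) => //.
    apply/measurable_wrtP => //; apply: measurable_wrt_ae (mv t t0) => //.
    by apply: filterS goodP => w gw; rewrite /v'; case: pselect.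
  - move=> [w x] t t0 /=; rewrite /v'; case: pselect => [gw|ngw] /=.
      exact: continuous_right_continuous_at gw.1 t0.
    by move=> e e0; exists 1 => // u _ _; rewrite subrr normr0.
  - by apply: (@measurable_maxr _ _ _ _ snd (cst 0)) => //; exact: measurable_snd.
  - by move=> z; rewrite le_max lexx orbT.
pose F (z : S * R) := (f z * \1_(`[0, s]) z.2)%:E.
have mF : measurable_fun setT F.
  apply/measurable_EFinP; apply: measurable_funM => //.
  apply: (@measurableT_comp _ _ _ _ _ _ (\1_(`[0, s]%classic) : R -> R)) => //.
have F0 z : (0 <= F z)%E.
  by rewrite lee_fin mulr_ge0// v'0// le_max lexx orbT.
have := @measurable_fun_fubini_tonelli_F _ _ _ _ _ (@lebesgue_measure R) F mF F0.
move=> mI; rewrite [X in measurable_fun _ X](_ : _ =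
  fine \o fubini_F lebesgue_measure F).
  by apply: measurableT_comp => //; exact: fine_measurable.
apply/funext => w; rewrite /time_change /Rintegral /= /fubini_F; congr fine.
rewrite [LHS]integral_mkcond; apply: eq_integral => x _.
rewrite /patch /F /f/= indicE; case: ifPn => [|]; rewrite ?mulr0 ?mulr1 //.
by rewrite inE/= in_itv/= => /andP[x0 _]; rewrite max_l.
Qed.

End measurability.

(** * Brownian motion and an independent sigma-field *)

Section generated_by_random_variables.
Context {d : measure_display} {Omega : measurableType d} {R : realType}.
Implicit Types (V : set (Omega -> R)) (H : set (set Omega)).

Lemma sigma_rv_subset V H : sigma_algebra setT H ->
  (forall f, V f -> measurable_wrt H f) -> sigma_rv V `<=` H.
Proof.
by move=> sH VH; apply: g_sigma_algebra_subset => // _ [f /VH mf [A mA <-]]; exact: mf.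
Qed.

Lemma sigma_rv_measurable_wrt V (f : Omega -> R) : V f -> measurable_wrt (sigma_rv V) f.
Proof. by move=> Vf A mA; apply: sub_sigma_algebra; exists f => //; exists A. Qed.

Lemma sigma_rvP V : sigma_algebra setT (sigma_rv V).
Proof. exact: g_sigma_algebraP. Qed.

Lemma sigma_rvS V V' : V `<=` V' -> sigma_rv V `<=` sigma_rv V'.
Proof.
move=> VV'; apply: sigma_rv_subset; first exact: sigma_rvP.
by move=> f /VV'; exact: sigma_rv_measurable_wrt.
Qed.

Lemma measurable_wrt_measurable (f : Omega -> R) :
  measurable_fun setT f -> measurable_wrt measurable f.
Proof. by move=> mf A mA; rewrite -[X in measurable X]setTI; exact: mf. Qed.

Lemma whole_measurable (Xs : set (R -> Omega -> R)) :
  (forall X t, Xs X -> 0 <= t -> measurable_fun setT (X t)) ->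
  whole Xs `<=` measurable.
Proof.
move=> mX; apply: sigma_rv_subset; first exact: sigma_algebra_measurable.
move=> _ [X XX [t /= + <-]]; rewrite in_itv/= andbT => t0.
by apply: measurable_wrt_measurable; exact: mX.
Qed.

Lemma whole_measurable_wrt (Xs : set (R -> Omega -> R)) X t :
  Xs X -> 0 <= t -> measurable_wrt (whole Xs) (X t).
Proof.
move=> XX t0; apply: sigma_rv_measurable_wrt; exists X => //; exists t => //=.
by rewrite in_itv/= t0.
Qed.

Lemma past_measurable_wrt (Xs : set (R -> Omega -> R)) X s t :
  Xs X -> 0 <= s -> s <= t -> measurable_wrt (past Xs t) (X s).
Proof.
move=> XX s0 st; apply: sigma_rv_measurable_wrt; exists X => //; exists s => //=.
by rewrite in_itv/= s0.
Qed.

Lemma pastS (Xs : set (R -> Omega -> R)) s t : s <= t -> past Xs s `<=` past Xs t.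
Proof.
move=> st; apply: sigma_rvS => _ [X XX [u /= + <-]]; rewrite in_itv/= => /andP[u0 us].
by exists X => //; exists u => //=; rewrite in_itv/= u0 (le_trans us).
Qed.

Lemma past_whole (Xs : set (R -> Omega -> R)) t : past Xs t `<=` whole Xs.
Proof.
apply: sigma_rvS => _ [X XX [u /= + <-]]; rewrite in_itv/= => /andP[u0 us].
by exists X => //; exists u => //=; rewrite in_itv/= u0.
Qed.

Lemma wholeS (Xs Xs' : set (R -> Omega -> R)) : Xs `<=` Xs' -> whole Xs `<=` whole Xs'.
Proof.
by move=> XX; apply: sigma_rvS => _ [X /XX ? [u ? <-]]; exists X => //; exists u.
Qed.

Lemma measurable_wrtD H (f g : Omega -> R) : sigma_algebra setT H ->
  measurable_wrt H f -> measurable_wrt H g -> measurable_wrt H (f \+ g).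
Proof.
move=> sH /measurable_wrtP-/(_ sH) mf /measurable_wrtP-/(_ sH) mg.
by apply/measurable_wrtP => //; exact: measurable_funD.
Qed.

Lemma measurable_wrtM H (k : R) (f : Omega -> R) : sigma_algebra setT H ->
  measurable_wrt H f -> measurable_wrt H (fun w => k * f w).
Proof.
move=> sH /measurable_wrtP-/(_ sH) mf.
by apply/measurable_wrtP => //; exact: measurable_funM.
Qed.

Lemma measurable_wrtB H (f g : Omega -> R) : sigma_algebra setT H ->
  measurable_wrt H f -> measurable_wrt H g -> measurable_wrt H (f \- g).
Proof.
move=> sH /measurable_wrtP-/(_ sH) mf /measurable_wrtP-/(_ sH) mg.
by apply/measurable_wrtP => //; exact: measurable_funB.
Qed.

Lemma measurable_wrt_normr_le H (f : Omega -> R) (k : R) : sigma_algebra setT H ->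
  measurable_wrt H f -> H [set w | `|f w| <= k].
Proof.
move=> sH mf; rewrite [X in H X](_ : _ = f @^-1` `[- k, k]).
  by apply: mf; exact: measurable_itv.
by apply/seteqP; split => w /=; rewrite in_itv/= ler_norml.
Qed.

Lemma measurable_wrt_le H (f : Omega -> R) (k : R) :
  measurable_wrt H f -> H [set w | f w <= k].
Proof.
move=> mf; rewrite [X in H X](_ : _ = f @^-1` `]-oo, k]).
  by apply: mf; exact: measurable_itv.
by apply/seteqP; split => w /=; rewrite in_itv.
Qed.

Lemma measurable_wrt_lt H (f : Omega -> R) (k : R) :
  measurable_wrt H f -> H [set w | f w < k].
Proof.
move=> mf; rewrite [X in H X](_ : _ = f @^-1` `]-oo, k[).
  by apply: mf; exact: measurable_itv.
by apply/seteqP; split => w /=; rewrite in_itv.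
Qed.

End generated_by_random_variables.

Section normal_support.
Context {R : realType}.

(** On [[a, b]] the density is bounded below by its minimum, which is positive. *)
Lemma normal_prob_itv_gt0 (s a b : R) : s != 0 -> a < b ->
  (0 < normal_prob 0 s `]a, b[%classic)%E.
Proof.
move=> s0 ab; have cf : {within `[a, b], continuous (normal_pdf 0 s)}.
  by apply: continuous_subspaceT; exact: continuous_normal_pdf.
have [c _ cmin] := EVT_min (ltW ab) cf.
have c0 : 0 < normal_pdf 0 s c.
  by rewrite normal_pdfE// mulr_gt0 ?expR_gt0// normal_peak_gt0.
have : ((normal_pdf 0 s c)%:E * lebesgue_measure `]a, b[%classic <=
  normal_prob 0 s `]a, b[%classic)%E.
  rewrite -integral_cst//; apply: ge0_le_integral => //.
  - by move=> x _; rewrite lee_fin ltW.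
  - apply/measurable_EFinP; apply: measurable_funTS; exact: measurable_normal_pdf.
  - by move=> x xab; rewrite lee_fin cmin//; apply: subset_itv_oo_cc.
apply: lt_le_trans; rewrite lebesgue_measure_itv/= lte_fin ab -EFinB -EFinM lte_fin.
by rewrite mulr_gt0// subr_gt0.
Qed.

Lemma normal_prob_halfline_gt0 (s k x : R) : s != 0 -> k != 0 ->
  (0 < normal_prob 0 s [set y | (k * y < x)%R])%E.
Proof.
move=> s0 k0; set S := [set y | _].
have mS : measurable S.
  rewrite [S](_ : _ = ( *%R k) @^-1` `]-oo, x[).
    by rewrite -[X in measurable X]setTI; apply: measurable_funM.
  by apply/seteqP; split => y; rewrite /= in_itv.
suff [a [b [ab abS]]] : exists a b, a < b /\ `]a, b[%classic `<=` S.
  apply: lt_le_trans (normal_prob_itv_gt0 s0 ab) _.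
  by apply: le_measure; rewrite ?inE.
have [k_gt0|k_le0] := ltP 0 k.
  exists (x / k - 1), (x / k); split; first by rewrite ltrBlDr ltrDl.
  by move=> y /=; rewrite in_itv/= => /andP[_]; rewrite ltr_pdivlMr// mulrC.
have k_lt0 : k < 0 by rewrite lt_neqAle k0.
exists (x / k), (x / k + 1); split; first by rewrite ltrDl.
by move=> y /=; rewrite in_itv/= => /andP[+ _]; rewrite ltr_ndivrMr// mulrC.
Qed.

End normal_support.

Section brownian.
Context {d : measure_display} {Omega : measurableType d} {R : realType}.
Variables (P : probability Omega R) (W : R -> Omega -> R) (G : set (set Omega)).
Hypothesis BW : brownian_motion P W.
Hypothesis sG : sigma_algebra setT G.
Hypothesis mG : G `<=` measurable.
Hypothesis GW : independent P G (whole [set W]).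

(** Initial enlargement: all of [G], which will carry the whole paths of [B] and [J], is known at
    every level [t] of [W]. *)
Definition enlarged_past (t : R) : set (set Omega) := <<s past [set W] t `|` G >>.

Lemma enlarged_pastP t : sigma_algebra setT (enlarged_past t).
Proof. exact: g_sigma_algebraP. Qed.

Lemma enlarged_past_measurable t : enlarged_past t `<=` measurable.
Proof.
apply: g_sigma_algebra_subset; first exact: sigma_algebra_measurable.
move=> A [pA|/mG//]; suff: whole [set W] `<=` measurable by apply; exact: past_whole pA.
by apply: whole_measurable => X u -> u0; case: BW => mW *; exact: mW.
Qed.

Lemma enlarged_pastS s t : s <= t -> enlarged_past s `<=` enlarged_past t.
Proof. by move=> st; apply: sub_sigma_algebra2; apply: setSU; exact: pastS. Qed.

Lemma sub_enlarged_past t : G `<=` enlarged_past t.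
Proof. by move=> A GA; apply: sub_sigma_algebra; right. Qed.

Lemma enlarged_past_measurable_wrt s t : 0 <= s -> s <= t ->
  measurable_wrt (enlarged_past t) (W s).
Proof.
move=> s0 st; apply: (@measurable_wrtS _ _ _ (past [set W] t)).
  by move=> A pA; apply: sub_sigma_algebra; left.
exact: past_measurable_wrt.
Qed.

Lemma independent_enlarged_past r t : 0 <= r -> r <= t ->
  independent P (enlarged_past r) (sigma_rv [set W t \- W r]).
Proof.
move=> r0 rt; apply: independent_sym.
have [mW _ IW _ _] := BW.
have sW : sigma_algebra setT (whole [set W]) by exact: sigma_rvP.
have mwW : whole [set W] `<=` measurable.
  by apply: whole_measurable => X u -> u0; exact: mW.
have IwW : sigma_rv [set W t \- W r] `<=` whole [set W].
  apply: sigma_rv_subset => // _ ->; apply: measurable_wrtB => //;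
    apply: whole_measurable_wrt => //; exact: le_trans rt.
have pwW : past [set W] r `<=` whole [set W] by exact: past_whole.
apply: independent_join => //.
- exact: sigma_rvP.
- exact: subset_trans IwW mwW.
- exact: subset_trans pwW mwW.
- by move=> A B; apply: sigma_algebra_setI; exact: sigma_rvP.
- by apply: sigma_algebra_setT; exact: sigma_rvP.
- by move=> A B; exact: sigma_algebra_setI.
- exact: sigma_algebra_setT.
- exact: IW.
- move=> A B C /IwW IA /pwW pB GC.
  have wAB : whole [set W] (A `&` B) by exact: (sigma_algebra_setI sW).
  by rewrite setIC GW// muleC.
Qed.

(** Induction on [n]: the increments up to [u n] belong to [enlarged_past (u n)], of which the next
    increment is independent. *)
Lemma independent_enlarged_past_grid (u : nat -> R) n : 0 <= u 0%N ->
  {homo u : i j / (i <= j)%N >-> i <= j} ->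
  independent P (enlarged_past (u 0%N))
    (sigma_rv [set W (u j) \- W (u 0%N) | j in [set j | (j <= n)%N]]).
Proof.
move=> u0 ndu; have ui j : 0 <= u j by exact: le_trans (ndu _ _ (leq0n j)).
have [mW _ _ _ _] := BW.
have sR V : sigma_algebra setT (@sigma_rv _ Omega R V) by exact: sigma_rvP.
have mI j k : sigma_rv [set W (u j) \- W (u k)] `<=` measurable.
  apply: sigma_rv_subset; first exact: sigma_algebra_measurable.
  by move=> f ->; apply: measurable_wrt_measurable; apply: measurable_funB; exact: mW.
elim: n => [|n IH].
  apply: (@independentS _ _ _ _ (enlarged_past (u 0%N)) _
    (sigma_rv [set W (u 0%N) \- W (u 0%N)])) => //.
    by apply: sigma_rvS => f [j /=]; rewrite leqn0 => /eqP -> <-.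
  exact: independent_enlarged_past.
set F := sigma_rv _ in IH; set I := sigma_rv [set W (u n.+1) \- W (u n)].
have Fpast : F `<=` enlarged_past (u n).
  apply: sigma_rv_subset; first exact: enlarged_pastP.
  move=> _ [j /= jn <-]; apply: measurable_wrtB; first exact: enlarged_pastP.
    by apply: enlarged_past_measurable_wrt => //; exact: ndu.
  by apply: enlarged_past_measurable_wrt => //; exact: ndu.
apply: (@independentS _ _ _ _ (enlarged_past (u 0%N)) _ <<s F `|` I >>) => //.
  apply: sigma_rv_subset; first exact: g_sigma_algebraP.
  have FFI : F `<=` <<s F `|` I >> by move=> A FA; apply: sub_sigma_algebra; left.
  have IFI : I `<=` <<s F `|` I >> by move=> A FA; apply: sub_sigma_algebra; right.
  move=> _ [j /= + <-]; rewrite leq_eqVlt ltnS => /predU1P[->|jn]; last first.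
    by apply: (measurable_wrtS FFI); apply: sigma_rv_measurable_wrt; exists j.
  rewrite (_ : _ \- _ = (W (u n.+1) \- W (u n)) \+ (W (u n) \- W (u 0%N))); last first.
    by apply/funext => w /=; rewrite addrA subrK.
  apply: measurable_wrtD; first exact: g_sigma_algebraP.
    by apply: (measurable_wrtS IFI); exact: sigma_rv_measurable_wrt.
  by apply: (measurable_wrtS FFI); apply: sigma_rv_measurable_wrt; exists n => /=.
apply: independent_join => //.
- exact: enlarged_pastP.
- exact: enlarged_past_measurable.
- by apply: subset_trans Fpast _; exact: enlarged_past_measurable.
- by move=> A B; apply: sigma_algebra_setI; exact: sR.
- by apply: sigma_algebra_setT; exact: sR.
- exact: mI.
- by move=> A B; apply: sigma_algebra_setI; exact: sR.
- by apply: sigma_algebra_setT; exact: sR.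
- move=> A B C HA FB IC; apply: (independent_enlarged_past (ui n) (ndu _ _ (leqnSn n))) => //.
  apply: (sigma_algebra_setI (@enlarged_pastP (u n))); last exact: Fpast.
  by apply: enlarged_pastS HA; exact: ndu.
Qed.

(* The oscillation of W after time r is a limit of events depending on dyadic
   grids only, each of them independent of the past up to r. *)
Lemma oscillation_event (r M : R) : 0 <= r -> 0 < M ->
  exists (K : nat) (E : set Omega), [/\ measurable E,
    {ae P, forall w, E w -> forall t, r <= t -> t <= r + M ->
      `|W t w - W r w| <= K%:R} &
    forall A, enlarged_past r A -> (0 < P A)%E -> (0 < P (A `&` E))%E].
Proof.
move=> r0 M0; have [mW _ _ _ cW] := BW.
pose u n i : R := r + i%:R * (M / (2 ^ n)%:R).
have p0 n : 0 < M / (2 ^ n)%:R :> R by rewrite divr_gt0// ltr0n expn_gt0.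
have u0 n : u n 0%N = r by rewrite /u mul0r addr0.
have ndu n : {homo u n : i j / (i <= j)%N >-> i <= j}.
  by move=> i j ij; rewrite lerD2l ler_pM2r// ler_nat.
have ru n i : r <= u n i by rewrite -(u0 n); exact: ndu.
have uM n i : (i <= 2 ^ n)%N -> u n i <= r + M.
  move=> i2; rewrite lerD2l mulrCA ler_piMr ?(ltW M0)//.
  by rewrite ler_pdivrMr ?ltr0n ?expn_gt0// mul1r ler_nat.
pose g (K n : nat) : set Omega := [set w | forall i : nat, (i <= 2 ^ n)%N ->
  `|W (u n i) w - W r w| <= K%:R].
have gF K n : sigma_rv [set W (u n j) \- W (u n 0%N) | j in [set j | (j <= 2 ^ n)%N]]
    (g K n).
  apply: sigma_algebra_countable_forall; first exact: sigma_rvP.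
  move=> i i2; apply: (@measurable_wrt_normr_le _ _ _ _ (W (u n i) \- W r)).
    exact: sigma_rvP.
  by apply: sigma_rv_measurable_wrt; exists i => //; rewrite u0.
have mg K n : measurable (g K n).
  move: (gF K n); apply: sigma_rv_subset; first exact: sigma_algebra_measurable.
  move=> _ [j _ <-]; apply: measurable_wrt_measurable; apply: measurable_funB;
    by apply: mW; exact: le_trans (ru _ _).
pose E K := \bigcap_n g K n.
have mE K : measurable (E K) by exact: bigcapT_measurable.
(* Almost every path is bounded on [[r, r + M]], so the events [E K] cover the space and one of them
   has positive probability. *)
have [||K EK] := @probability_gt0_exists _ _ _ P nat setT E measurableT mE.
- apply: filterS cW => w cw _.
  have [n hn] := @continuous_segment_bounded _ (W^~ w) (r + M) cw.
  (* One [n] bounds [W] at the grid point, the other bounds [W r]. *)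
  exists (n + n)%N => m _ i i2; rewrite natrD (le_trans (ler_normB _ _))// lerD//.
    by apply: hn; [exact: le_trans (ru _ _)|exact: uM].
  by apply: hn => //; rewrite lerDl ltW.
- by rewrite probability_setT lte_fin.
rewrite setTI in EK; move: EK => EK0.
exists K, (E K); split => //.
  apply: filterS cW => w cw Ew t rt tM.
  have t0 : 0 <= t by exact: le_trans rt.
  apply/ler_addgt0Pr => e e0.
  have [D D0 hD] := continuous_halflineP cw t0 e0.
  have [n hn] : exists n : nat, M / (2 ^ n)%:R < D.
    exists (Num.truncn (M / D)).+1.
    rewrite ltr_pdivrMr ?ltr0n ?expn_gt0// mulrC -ltr_pdivrMr//.
    by rewrite (lt_trans (truncnS_gt _))// ltr_nat ltn_expl.
  pose i := Num.truncn ((t - r) / (M / (2 ^ n)%:R)).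
  have /andP[il ir] : i%:R * (M / (2 ^ n)%:R) <= t - r < i.+1%:R * (M / (2 ^ n)%:R).
    rewrite -ler_pdivlMr// -ltr_pdivrMr//; apply: truncn_itv.
    by rewrite divr_ge0 ?subr_ge0// ltW.
  have i2 : (i <= 2 ^ n)%N.
    have : i%:R * (M / (2 ^ n)%:R) <= M by rewrite (le_trans il)// lerBlDr addrC.
    rewrite mulrCA ger_pMr// ler_pdivrMr ?ltr0n ?expn_gt0// mul1r ler_nat//.
  have h1 : `|W (u n i) w - W r w| <= K%:R by exact: (Ew n I i i2).
  have h2 : `|W (u n i) w - W t w| < e.
    apply: hD; first exact: le_trans (ru _ _).
    rewrite /u ltr_norml; move: ir il; rewrite -natr1 mulrDl mul1r => ir il.
    by apply/andP; split; lra.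
  rewrite (_ : W t w - W r w = (W (u n i) w - W r w) - (W (u n i) w - W t w)); last by lra.
  by rewrite (le_trans (ler_normB _ _))// lerD// ltW.
move=> A HA A0; have mA := enlarged_past_measurable HA.
apply: (@lt_le_trans _ _ (P A * P (E K))%E); first exact: mule_gt0.
(* The limit is decreasing, and each term equals [P A * P (g K n)], which is at least
   [P A * P (E K)]. *)
have cv : P (A `&` g K n) @[n --> \oo] --> P (A `&` E K).
  rewrite (_ : A `&` E K = \bigcap_n (A `&` g K n)); last first.
    by apply/seteqP; split => [w [Aw Ew] n _|w h]; split; [|exact: Ew|have [] := h 0%N I|
      move=> n _; have [] := h n I].
  apply: nonincreasing_cvg_mu.
  - by rewrite (le_lt_trans (probability_le1 _ _)) ?ltry//; exact: measurableI.
  - by move=> n; exact: measurableI.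
  - by apply: bigcapT_measurable => n; exact: measurableI.
  - apply/nonincreasing_seqP => n; apply/subsetPset; apply: setIS => w gw i i2.
    (* The grids are nested: point [i] of grid [n] is point [2 i] of grid [n + 1]. *)
    have := gw i.*2; rewrite expnS mul2n leq_double => /(_ i2).
    rewrite (_ : u n.+1 i.*2 = u n i)// /u expnS natrM -mul2n natrM.
    by congr (_ + _); rewrite invfM; field; rewrite pnatr_eq0 expn_eq0.
apply: (cvge_to_ge cv); near=> n.
have -> : P (A `&` g K n) = (P A * P (g K n))%E.
  by apply: (independent_enlarged_past_grid (u := u n) (n := 2 ^ n)) => //; rewrite u0.
by rewrite lee_pmul2l ?fin_num_measure//; apply: le_measure; rewrite ?inE//; exact: bigcap_inf.
Unshelve. all: by end_near. Qed.

(** The oscillation bound [K] after [r1] is fixed first. The Gaussian increment over [[r, r1]] then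
    overshoots the level [x] by the margin [|k| K], so that the later oscillation cannot undo it. *)
Lemma brownian_sweep (r r1 M k x : R) A : 0 <= r -> r < r1 -> 0 < M -> k != 0 ->
  enlarged_past r A -> (0 < P A)%E ->
  exists E : set Omega, [/\ measurable E, (0 < P (A `&` E))%E &
    {ae P, forall w, E w -> forall t, r1 <= t -> t <= r1 + M ->
      k * (W t w - W r w) < x}].
Proof.
move=> r0 rr1 M0 k0 HA A0; have r10 : 0 <= r1 by exact: le_trans (ltW rr1).
have [K [E [mE EK EA]]] := oscillation_event r10 M0.
have [mW _ _ NW _] := BW.
pose D := [set w | k * (W r1 w - W r w) < x - `|k| * K%:R].
have mS : measurable [set y | k * y < x - `|k| * K%:R].
  rewrite [S in measurable S](_ : _ = ( *%R k) @^-1` `]-oo, x - `|k| * K%:R[).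
    by rewrite -[X in measurable X]setTI; apply: measurable_funM.
  by apply/seteqP; split => y; rewrite /= in_itv.
have ID : sigma_rv [set W r1 \- W r] D.
  by apply: (@sigma_rv_measurable_wrt _ _ _ [set W r1 \- W r] (W r1 \- W r)) mS.
have PD : (0 < P D)%E.
  have := NW r r1 r0 rr1 _ mS; rewrite /pushforward => ->.
  by apply: normal_prob_halfline_gt0 => //; rewrite gt_eqF// sqrtr_gt0 subr_gt0.
have HD : enlarged_past r1 D.
  move: ID; apply: sigma_rv_subset; first exact: enlarged_pastP.
  move=> _ ->; apply: measurable_wrtB; first exact: enlarged_pastP.
    exact: enlarged_past_measurable_wrt.
  by apply: enlarged_past_measurable_wrt => //; exact: ltW.
have HAD : enlarged_past r1 (A `&` D).
  apply: (sigma_algebra_setI (@enlarged_pastP r1)) => //.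
  by apply: enlarged_pastS HA; exact: ltW.
exists (D `&` E); split.
- by apply: measurableI => //; exact: enlarged_past_measurable HD.
- rewrite setIA EA// (independent_enlarged_past r0 (ltW rr1))//.
  exact: mule_gt0.
- apply: filterS EK => w EKw [Dw /EKw h] t r1t tM.
  have {}h := h t r1t tM.
  have : k * (W t w - W r1 w) <= `|k| * K%:R.
    by rewrite (le_trans (ler_norm _))// normrM ler_wpM2l.
  by move: Dw; rewrite /D/= => ? ?; lra.
Qed.

End brownian.

(** * Paths of the subordinator and of the time change *)

Section subordinator_path.
Context {R : realType}.
Variables (J L : R -> R) (b : R).
Hypothesis ndJ : forall s t, 0 <= s -> s <= t -> J s <= J t.
Hypothesis LL : forall t, 0 < t -> cvg (L u @[u --> t^'-]).
Hypothesis JL : forall t, 0 <= t -> J t = b * t + L t.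
Let jmp s := L s - lim (L u @[u --> s^'-]).
Hypothesis LE : forall t, 0 <= t -> (L t)%:E = \esum_(s in `]0, t]) (jmp s)%:E.

(** Let [u] increase to [t] in [J s <= J u = b * u + L u]. The sign of [b] is still unknown here,
    whence [|b|] in the estimates. *)
Let jmp_le s t : 0 <= s -> s < t -> jmp t <= J t - J s.
Proof.
move=> s0 st; have t0 : 0 < t by exact: le_lt_trans st.
have cL := LL t0.
suff : J s - `|b| * 0 - b * t <= lim (L u @[u --> t^'-]).
  by rewrite /jmp (JL (ltW t0)); lra.
apply/ler_addgt0Pr => e e0; rewrite -lerBlDr; apply: limr_ge => //.
have e'0 : 0 < e / (`|b| + 1) by rewrite divr_gt0// ltr_wpDl.
near=> u; have su : s < u by near: u; exact: nbhs_left_gt.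
have ut : u < t by near: u; exact: nbhs_left_lt.
have ue : t - e / (`|b| + 1) < u by near: u; apply: nbhs_left_gt; rewrite ltrBlDr ltrDl.
have := ndJ s0 (ltW su); rewrite (@JL u) ?(le_trans s0 (ltW su))//.
have : b * (u - t) <= e.
  rewrite (le_trans (ler_norm _))// normrM distrC [`|t - u|]ger0_norm ?subr_ge0 ?(ltW ut)//.
  have : t - u < e / (`|b| + 1) by lra.
  by rewrite ltr_pdivlMr ?ltr_wpDl//; lra.
by move=> *; lra.
Unshelve. all: by end_near. Qed.

Let sum_jmp_le s t (l : seq R) : 0 <= s -> s <= t -> path <%R s l ->
  all (fun x => x <= t) l -> \sum_(x <- l) jmp x <= J t - J s.
Proof.
elim: l s => [|x l IH] s s0 st /=; first by rewrite big_nil subr_ge0 ndJ.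
move=> /andP[sx pl] /andP[xt al]; rewrite big_cons.
have := jmp_le s0 sx; have := IH x (ltW (le_lt_trans s0 sx)) xt pl al; lra.
Qed.

(** The decomposition only says that [b] is nonzero; its sign comes from monotonicity of [J].
    Finitely many jumps in []0, 1]] add up to at most [J 1], so [L 1 <= J 1 = b + L 1]. *)
Lemma drift_ge0 : 0 <= b.
Proof.
have L0 : L 0 = 0.
  apply: EFin_inj; rewrite LE// (_ : `]0, 0]%classic = set0) ?esum_set0//.
  by apply/seteqP; split => x //=; rewrite in_itv/=; lra.
have J0 : J 0 = 0 by rewrite JL// L0 mulr0 addr0.
suff : L 1 <= J 1 by rewrite (@JL 1)//; lra.
rewrite -lee_fin LE//; apply: ge_ereal_sup => _ [A [fA A1] <-].
rewrite fsbig_finite//= sumEFin lee_fin.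
(* Listing the jump times in increasing order lets the increments of [J] telescope. *)
rewrite (perm_big (sort <=%R (finmap.enum_fset (fset_set A)))) /=; last first.
  by rewrite perm_sym perm_sort.
have inA x : x \in sort <=%R (finmap.enum_fset (fset_set A)) -> 0 < x <= 1.
  rewrite mem_sort => xA; have : A x by move: xA; rewrite in_fset_set// inE.
  by move=> /A1; rewrite /= in_itv.
have := @sum_jmp_le 0 1 (sort <=%R (finmap.enum_fset (fset_set A))) (lexx 0) ler01.
rewrite J0 subr0; apply; last by apply/allP => x /inA /andP[].
rewrite path_min_sorted; last by apply/allP => x /inA /andP[].
by rewrite sort_lt_sorted finmap.fset_uniq.
Qed.

(** [L] is nondecreasing, being a supremum of finite sums over subsets of []0, t]], a set that grows
    with [t]. *)
Lemma drift_increment s t : 0 <= s -> s <= t -> b * (t - s) <= J t - J s.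
Proof.
move=> s0 st; have t0 : 0 <= t by exact: le_trans st.
suff : L s <= L t by rewrite (JL s0) (JL t0); lra.
rewrite -lee_fin (LE s0) (LE t0); apply: le_ereal_sup => _ [A [fA As] <-].
exists A => //; split=> // x /As /=; rewrite !in_itv/= => /andP[-> xs].
exact: le_trans st.
Qed.

Lemma subordinator_path0 : J 0 = 0.
Proof.
have L0 : L 0 = 0.
  apply: EFin_inj; rewrite LE// (_ : `]0, 0]%classic = set0) ?esum_set0//.
  by apply/seteqP; split => x //=; rewrite in_itv/=; lra.
by rewrite JL// L0 mulr0 addr0.
Qed.

End subordinator_path.

Section time_change_path.
Context {d : measure_display} {Omega : measurableType d} {R : realType}.
Variables (v : R -> Omega -> R) (w : Omega).
Hypothesis cv : {within `[0, +oo[, continuous (v^~ w)}.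
Hypothesis v0 : forall t, 0 <= t -> 0 <= v t w.

Let intv t : lebesgue_measure.-integrable `[0, t] (EFin \o v^~ w).
Proof.
apply: continuous_compact_integrable; first exact: segment_compact.
by apply: continuous_subspaceW cv => x /=; rewrite !in_itv/= => /andP[->].
Qed.

Lemma time_change_ge0 t : 0 <= time_change v t w.
Proof.
apply: Rintegral_ge0 => // s /=; rewrite in_itv/= => /andP[s0 _]; exact: v0.
Qed.

Lemma time_change_le s t : s <= t -> time_change v s w <= time_change v t w.
Proof.
move=> st; rewrite /time_change /Rintegral fine_le//; try exact: integrable_fin_num.
apply: ge0_subset_integral => //.
- by have /integrableP[] := intv t.
- by move=> x /=; rewrite in_itv/= => /andP[x0 _]; rewrite lee_fin v0.
- by move=> x /=; rewrite !in_itv/= => /andP[-> xs]; exact: le_trans st.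
Qed.

Lemma time_change_right_continuous t : 0 <= t ->
  right_continuous_at (fun s => time_change v s w) t.
Proof.
move=> t0 e e0; have t10 : 0 <= t + 1 by rewrite addr_ge0.
have cI := parameterized_integral_continuous t10 (intv (t + 1)).
have [|D D0 hD] := continuous_withinP cI (t := t) _ e0.
  by rewrite /= in_itv/= t0 lerDl ler01.
exists (Num.min D 1); first by rewrite lt_min D0/=.
move=> u tu; rewrite -ltrBlDl lt_min => /andP[uD u1]; apply: hD.
  by rewrite /= in_itv/= (le_trans t0 tu)/= -lerBlDl ltW.
by rewrite ger0_norm ?subr_ge0.
Qed.

End time_change_path.

(** * The log-price *)

Section model.
Context {d : measure_display} {Omega : measurableType d} {R : realType}.
Variables (P : probability Omega R) (B W J v : R -> Omega -> R).
Variables (alpha beta rho b : R) (delta : R -> R).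
Hypothesis mN : P.-negligible `<=` measurable.
Hypothesis BB : brownian_motion P B.
Hypothesis BW : brownian_motion P W.
Hypothesis iBW : independent P (whole [set B]) (whole [set W]).
Hypothesis mJ : forall t, 0 <= t -> measurable_fun setT (J t).
Hypothesis iJ : independent P (whole [set J]) (whole [set B; W]).
Hypothesis av : adapted (augmentation P [set B]) v.
Hypothesis cv : continuous_paths P v.
Hypothesis v0 : {ae P, forall w t, 0 <= t -> 0 <= v t w}.
Hypothesis cJ : {ae P, forall w t, 0 <= t -> right_continuous_at (J^~ w) t}.
Hypothesis J0 : {ae P, forall w, J 0 w = 0}.
Hypothesis ndJ : nondecreasing_paths P J.
Hypothesis b0 : 0 < b.
Hypothesis bJ : {ae P, forall w s t, 0 <= s -> s <= t -> b * (t - s) <= J t w - J s w}.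
Hypothesis delta0 : forall h, 0 < h -> 0 < delta h.
Hypothesis deltaT : forall t h, 0 < t -> 0 < h ->
  {ae P, forall w, delta h <= time_change v (t + h) w - time_change v t w}.
Hypothesis W0 : beta * Num.sqrt (1 - rho ^+ 2) != 0.

Local Notation T := (time_change v).

Definition clock (t : R) (w : Omega) : R := J (T t w) w.

Definition log_price (t : R) (w : Omega) : R :=
  alpha * clock t w + beta * (rho * B (clock t w) w +
    Num.sqrt (1 - rho ^+ 2) * W (clock t w) w).

Local Notation C := clock.
Local Notation Y := log_price.

Let good w := [/\ {within `[0, +oo[, continuous (B^~ w)},
  {within `[0, +oo[, continuous (W^~ w)},
  {within `[0, +oo[, continuous (v^~ w)} &
  forall t, 0 <= t -> 0 <= v t w] /\
  [/\ forall t, 0 <= t -> right_continuous_at (J^~ w) t, J 0 w = 0,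
  forall s t, 0 <= s -> s <= t -> J s w <= J t w &
  forall s t, 0 <= s -> s <= t -> b * (t - s) <= J t w - J s w].

Let goodP : {ae P, forall w, good w}.
Proof.
have [_ _ _ _ cB] := BB; have [_ _ _ _ cW] := BW.
near=> w; do 2!split.
- by near: w; exact: cB.
- by near: w; exact: cW.
- by near: w; exact: cv.
- by near: w; exact: v0.
- by near: w; exact: cJ.
- by near: w; exact: J0.
- by near: w; exact: ndJ.
- by near: w; exact: bJ.
Unshelve. all: by end_near. Qed.

Let T_ge0 w t : good w -> 0 <= T t w.
Proof. by move=> [[_ _ cw vw] _]; exact: time_change_ge0. Qed.

Let T_le w s t : good w -> s <= t -> T s w <= T t w.
Proof. by move=> [[_ _ cw vw] _]; exact: time_change_le. Qed.

Let T_rc w t : good w -> 0 <= t -> right_continuous_at (T^~ w) t.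
Proof. by move=> [[_ _ cw vw] _]; exact: time_change_right_continuous. Qed.

Let C_ge0 w t : good w -> 0 <= C t w.
Proof.
move=> gw; have [_ [_ Jw0 nd _]] := gw.
by rewrite -Jw0; apply: nd => //; exact: T_ge0.
Qed.

Let C_le w s t : good w -> s <= t -> C s w <= C t w.
Proof.
by move=> gw st; have [_ [_ _ nd _]] := gw; apply: nd; [exact: T_ge0|exact: T_le].
Qed.

Let C_rc w t : good w -> 0 <= t -> right_continuous_at (C^~ w) t.
Proof.
move=> gw t0; have [_ [rc _ _ _]] := gw.
apply: (@right_continuous_at_comp _ (T^~ w) (J^~ w)) => //.
- by move=> x y _ _; exact: T_le.
- exact: T_rc.
- exact/rc/T_ge0.
Qed.

Let sampled_rc (X : R -> Omega -> R) w t : {within `[0, +oo[, continuous (X^~ w)} ->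
  good w -> 0 <= t -> right_continuous_at (fun s => X (C s w) w) t.
Proof.
move=> cX gw t0; apply: (@right_continuous_at_comp _ (C^~ w) (X^~ w)) => //.
- by move=> x y _ _; exact: C_le.
- exact: C_rc.
- by apply: continuous_right_continuous_at => //; exact: C_ge0.
Qed.

Lemma log_price_right_continuous :
  {ae P, forall w t, 0 <= t -> right_continuous_at (Y^~ w) t}.
Proof.
apply: filterS goodP => w gw t t0; have [[cB cW _ _] _] := gw.
apply: right_continuous_atD; first by apply: right_continuous_atM; exact: C_rc.
apply: right_continuous_atM; apply: right_continuous_atD;
  by apply: right_continuous_atM; exact: sampled_rc.
Qed.

(** Up to time [N] the clock stays in [[0, C N w]], a compact interval on which the continuous paths
    of [B] and [W] are bounded. *)
Lemma log_price_bounded (N : R) :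
  {ae P, forall w, exists n : nat, forall t, 0 <= t -> t <= N -> `|Y t w| <= n%:R}.
Proof.
apply: filterS goodP => w gw; have [[cB cW _ _] _] := gw.
have [n1 h1] := continuous_segment_bounded (C N w) cB.
have [n2 h2] := continuous_segment_bounded (C N w) cW.
pose K := `|alpha| * C N w + `|beta| * (`|rho| * n1%:R + Num.sqrt (1 - rho ^+ 2) * n2%:R).
exists (Num.truncn K).+1 => t t0 tN; apply: le_trans (ltW (truncnS_gt _)).
have CN := C_le gw tN; have Ct := C_ge0 t gw.
rewrite (le_trans (ler_normD _ _))// lerD//.
  by rewrite normrM (ger0_norm Ct) ler_wpM2l.
rewrite normrM ler_wpM2l// (le_trans (ler_normD _ _))// !normrM.
by rewrite lerD// ?(ger0_norm (sqrtr_ge0 _)) ler_wpM2l//; [exact: h1|exact: h2].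
Qed.

Let sW : sigma_algebra setT (whole [set W]). Proof. exact: sigma_rvP. Qed.

Let mwB : whole [set B] `<=` measurable.
Proof. by apply: whole_measurable => X t ->; case: BB => + _ _ _ _; exact. Qed.

Let mwW : whole [set W] `<=` measurable.
Proof. by apply: whole_measurable => X t ->; case: BW => + _ _ _ _; exact. Qed.

Let mwJ : whole [set J] `<=` measurable.
Proof. by apply: whole_measurable => X t ->; exact: mJ. Qed.

Let BJ : set (set Omega) := <<s whole [set B] `|` whole [set J] >>.

Let mBJ : BJ `<=` measurable.
Proof.
apply: g_sigma_algebra_subset; first exact: sigma_algebra_measurable.
by move=> A [/mwB|/mwJ].
Qed.

(** Null sets are included because [v] is adapted to an augmented filtration and its paths are
    regular only almost surely. *)
Let G : set (set Omega) := <<s BJ `|` P.-negligible >>.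

Let sG : sigma_algebra setT G. Proof. exact: g_sigma_algebraP. Qed.

Let mG : G `<=` measurable.
Proof.
apply: g_sigma_algebra_subset; first exact: sigma_algebra_measurable.
by move=> A [/mBJ|/mN].
Qed.

Let NG : P.-negligible `<=` G.
Proof. by move=> A NA; apply: sub_sigma_algebra; right. Qed.

Let BG : whole [set B] `<=` G.
Proof.
by move=> A BA; apply: sub_sigma_algebra; left; apply: sub_sigma_algebra; left.
Qed.

Let JG : whole [set J] `<=` G.
Proof.
by move=> A BA; apply: sub_sigma_algebra; left; apply: sub_sigma_algebra; right.
Qed.

Let GW : independent P G (whole [set W]).
Proof.
apply: independent_sym; apply: independent_negligible => //.
- by move=> A A'; apply: (sigma_algebra_setI (g_sigma_algebraP _)).
- exact: (sigma_algebra_setT (g_sigma_algebraP _)).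
- have sR V : sigma_algebra setT (@sigma_rv _ Omega R V) by exact: sigma_rvP.
  apply: independent_join => //.
  + by move=> A A'; apply: (sigma_algebra_setI (sR _)).
  + exact: (sigma_algebra_setT (sR _)).
  + by move=> A A'; apply: (sigma_algebra_setI (sR _)).
  + exact: (sigma_algebra_setT (sR _)).
  + exact: independent_sym.
  + move=> A1 A2 A3 WA1 BA2 JA3; rewrite setIC iJ// 1?muleC//.
    apply: (sigma_algebra_setI (sR _)); first by apply: wholeS WA1 => X ->; right.
    by apply: wholeS BA2 => X ->; left.
Qed.

Let mT t : measurable_wrt G (T t).
Proof.
apply: (@measurable_wrt_time_change _ _ _ P) => // u u0 A mA.
(* The augmentation is an intersection over later times; taking the time [u + 1] is enough, since
   [G] contains all of [B]. *)
have := av u0 mA => /(_ (u + 1)); rewrite /= ltrDl ltr01 => /(_ isT).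
apply: g_sigma_algebra_subset => // A' [|/NG//].
by move=> /past_whole /BG.
Qed.

Let mC t : measurable_wrt G (C t).
Proof.
apply: (@measurable_wrt_sampling _ _ _ P) => //.
  by move=> u u0; apply: (measurable_wrtS JG); exact: whole_measurable_wrt.
by apply: filterS goodP => w gw; exact: T_ge0.
Qed.

Let mBC t : measurable_wrt G (fun w => B (C t w) w).
Proof.
apply: (@measurable_wrt_sampling _ _ _ P) => //.
- by move=> u u0; apply: (measurable_wrtS BG); exact: whole_measurable_wrt.
- apply: filterS goodP => w [[cB _ _ _] _] u u0.
  exact: continuous_right_continuous_at.
- by apply: filterS goodP => w gw; exact: C_ge0.
Qed.

Lemma log_price_measurable t : measurable_wrt measurable (Y t).
Proof.
have sM : sigma_algebra setT (@measurable _ Omega) by exact: sigma_algebra_measurable.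
have mC' : measurable_wrt measurable (C t) by exact: measurable_wrtS mG _.
apply: measurable_wrtD => //; first exact: measurable_wrtM.
apply: measurable_wrtM => //; apply: measurable_wrtD => //.
  by apply: measurable_wrtM => //; exact: measurable_wrtS mG _.
apply: measurable_wrtM => //; apply: (@measurable_wrt_sampling _ _ _ P) => //.
- by move=> u u0; apply: measurable_wrt_measurable; case: BW => + _ _ _ _; exact.
- apply: filterS goodP => w [[_ cW _ _] _] u u0.
  exact: continuous_right_continuous_at.
- by apply: filterS goodP => w gw; exact: C_ge0.
Qed.

Lemma time_change_measurable t : measurable_wrt measurable (T t).
Proof. exact: measurable_wrtS mG _. Qed.

Local Notation H := (enlarged_past W G).

(** The clock is known from [G]; capped at [r], it samples [W] only where [H r] knows it. *)
Let mWC t r : 0 <= r -> measurable_wrt (H r) (fun w => W (Num.min (C t w) r) w).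
Proof.
move=> r0; have sH : sigma_algebra setT (H r) by exact: enlarged_pastP.
apply: (@measurable_wrt_sampling _ _ _ P (H r) (fun u w => W (Num.min u r) w)) => //.
- by move=> A NA; apply: sub_enlarged_past; exact: NG.
- move=> u u0; apply: enlarged_past_measurable_wrt; last by rewrite ge_min lexx orbT.
  by rewrite le_min u0.
- apply: filterS goodP => w [[_ cW _ _] _] u u0 e e0.
  have m0 : 0 <= Num.min u r by rewrite le_min u0.
  have [D D0 hD] := continuous_halflineP cW m0 e0.
  exists D => // u' uu' u'D; apply: hD; first by rewrite le_min r0 (le_trans u0).
  have [ur|ur] := leP u r; have [u'r|u'r] := leP u' r.
  + by rewrite ger0_norm ?subr_ge0// ltrBlDl.
  + by rewrite ger0_norm ?subr_ge0//; lra.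
  + by lra.
  + by rewrite subrr normr0.
- exact: (measurable_wrtS (@sub_enlarged_past _ _ _ W G r)).
- by apply: filterS goodP => w gw; exact: C_ge0.
Qed.

(* On [clock p < r], the paths of (Y, T) up to time p only involve W up to r. *)
Let past_trace p r A : 0 <= r -> <<s past [set Y; T] p `|` P.-negligible >> A ->
  H r (A `&` [set w | C p w < r]).
Proof.
move=> r0; have sH : sigma_algebra setT (H r) by exact: enlarged_pastP.
have GH : G `<=` H r by exact: sub_enlarged_past.
have NH : P.-negligible `<=` H r by move=> A' NA; apply: GH; exact: NG.
have HD : H r [set w | C p w < r] by apply: GH; exact: measurable_wrt_lt.
(* The events whose trace on [D] lies in [H r] form a sigma-field, so generators suffice. *)
set D := [set w | _] in HD *; pose K := [set A | H r (A `&` D)].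
have sK : sigma_algebra setT K.
  split => [|A' KA'|F KF]; rewrite /K/=.
  - by rewrite set0I; case: sH.
  - rewrite (_ : _ `&` D = D `\` (A' `&` D)); first exact: (sigma_algebra_setD sH).
    by apply/seteqP; split => w /=; rewrite /setD/=; tauto.
  - by rewrite setI_bigcupl; case: sH => _ _; apply.
move: A; change (<<s past [set Y; T] p `|` P.-negligible >> `<=` K).
apply: g_sigma_algebra_subset => // A [|NA]; last first.
  by apply: NH; apply: negligibleS NA; exact: subIsetl.
move: A; apply: sigma_rv_subset => // _ [X XX [s /= + <-]]; rewrite in_itv/= => /andP[s0 sp].
move=> U mU; rewrite /K/=; case: XX => ->; last first.
  by apply: (sigma_algebra_setI sH) => //; apply: GH; exact: mT.
(* On [D], almost surely [C s <= C p < r], so the cap at [r] is inactive and [Y'] equals [Y s]. *)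
pose Y' w := alpha * C s w + beta * (rho * B (C s w) w +
    Num.sqrt (1 - rho ^+ 2) * W (Num.min (C s w) r) w).
have mY' : measurable_wrt (H r) Y'.
  apply: measurable_wrtD => //.
    by apply: measurable_wrtM => //; exact: (measurable_wrtS GH).
  apply: measurable_wrtM => //; apply: measurable_wrtD => //.
    by apply: measurable_wrtM => //; exact: (measurable_wrtS GH).
  by apply: measurable_wrtM => //; exact: mWC.
rewrite (_ : _ `&` D = (Y' @^-1` U `&` D) `&` [set w | C s w <= C p w] `|`
   ((Y s @^-1` U `&` D) `&` ~` [set w | C s w <= C p w])).
  have NC : P.-negligible (~` [set w | C s w <= C p w]).
    by apply: negligibleS goodP => w + gw; apply; exact: C_le.
  apply: (sigma_algebra_setU sH) => //.
    apply: (sigma_algebra_setI sH) => //; first by apply: (sigma_algebra_setI sH) => //; exact: mY'.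
    by rewrite -[X in H r X]setCK; apply: (sigma_algebra_setC sH); exact: NH.
  by apply: NH; apply: negligibleS NC; exact: subIsetr.
have YY' w : D w -> C s w <= C p w -> Y s w = Y' w.
  by move=> Dw sw; rewrite /Y' min_l// ltW// (le_lt_trans sw).
apply/seteqP; split => w /=.
  move=> [Uw Dw]; have [sw|sw] := pselect (C s w <= C p w); last by right.
  by left; split => //; split => //; rewrite -YY'.
by move=> [[[Uw Dw] sw]|[[]]]//; split => //; rewrite YY'.
Qed.

Let segment_le (f : R -> R) (N : R) (n : nat) t : {within `[0, +oo[, continuous f} ->
  (forall q : rat, 0 <= (ratr q : R) < N -> `|f (ratr q)| <= n%:R) ->
  0 <= t -> t < N -> `|f t| <= n%:R.
Proof.
move=> cf h t0 tN; have rc := continuous_right_continuous_at cf t0.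
rewrite ler_norml; apply/andP; split.
  rewrite lerNl -mulN1r.
  apply: (right_continuous_le_rat (a := 0) (b := N) (right_continuous_atM (-1) rc)) => //.
  by move=> q /h; rewrite mulN1r => /ler_normlP[].
by apply: (right_continuous_le_rat (a := 0) (b := N) rc) => // q /h /ler_normlP[].
Qed.

(* After time p + eta the clock has left its grid cell by at least one step, so
   that the Brownian increment after the end of the cell, independent of A, can
   be steered far beyond all other terms of Y, which are bounded on A'. *)
Lemma log_price_sweep (p eta K N k : R) (A : set Omega) : 0 < p -> 0 < eta -> k != 0 ->
  <<s past [set Y; T] p `|` P.-negligible >> A -> (0 < P A)%E ->
  exists A' : set Omega, [/\ A' `<=` A, measurable A', (0 < P A')%E &
    {ae P, forall w, A' w -> forall s, p + eta <= s -> s <= N -> k * Y s w < - K}].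
Proof.
move=> p0 eta0 k0 pA PA.
(* Half of the least advance of the clock over a time [eta]: from [m * step <= C p] it follows that
   [C (p + eta) >= (m + 2) * step], which is [r1], one step beyond the end [r] of the cell. *)
pose step := b * delta eta / 2.
have step0 : 0 < step by rewrite divr_gt0// mulr_gt0// delta0.
have mA : measurable A.
  move: pA; apply: g_sigma_algebra_subset; first exact: sigma_algebra_measurable.
  move=> A' [|/mN//]; apply: sigma_rv_subset; first exact: sigma_algebra_measurable.
  by move=> _ [X [->|->] [s _ <-]]; [exact: log_price_measurable|exact: time_change_measurable].
pose cell (m : nat) := [set w | m%:R * step <= C p w < m.+1%:R * step].
have Gcell m : G (cell m).
  rewrite (_ : cell m = [set w | C p w < m.+1%:R * step] `\` [set w | C p w < m%:R * step]).
    by apply: (sigma_algebra_setD sG) => //; exact: measurable_wrt_lt.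
  apply/seteqP; split => w; rewrite /cell/=.
    by move=> /andP[mCp pC]; split => //; rewrite ltNge mCp.
  by move=> [-> /negP]; rewrite -leNgt => ->.
have [m PA1] : exists m, (0 < P (A `&` cell m))%E.
  apply: probability_gt0_exists => //; first by move=> m; exact: mG.
  apply: filterS goodP => w gw _; exists (Num.truncn (C p w / step)); rewrite /cell/=.
  rewrite -ler_pdivlMr// -ltr_pdivrMr//; apply: truncn_itv.
  by rewrite divr_ge0 ?C_ge0// ltW.
pose r := m.+1%:R * step; pose r1 := r + step.
have r0 : 0 <= r by rewrite mulr_ge0// ltW.
have sH : sigma_algebra setT (H r) by exact: enlarged_pastP.
have GH : G `<=` H r by exact: sub_enlarged_past.
have mH : H r `<=` measurable by exact: (enlarged_past_measurable BW mG).
have HA1 : H r (A `&` cell m).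
  rewrite (_ : _ `&` _ = (A `&` [set w | C p w < r]) `&` cell m).
    by apply: (sigma_algebra_setI sH) => //; [exact: past_trace|exact: GH].
  by apply/seteqP; split => w; [move=> [Aw /[dup] cw /andP[]]|move=> [[]]].
(* Although [C N] concerns the future, bounding it is an event of [G], hence of [H r]. It gives the
   sweep of [W] a finite horizon. *)
have [n1 PA2] : exists n1 : nat, (0 < P (A `&` cell m `&` [set w | (C N w <= n1%:R)%R]))%E.
  apply: probability_gt0_exists => //; first exact: mH.
    by move=> n; apply/mG; exact: measurable_wrt_le.
  apply: aeW => w _; exists (Num.truncn (C N w)).+1 => /=; exact: ltW (truncnS_gt _).
set A2 := _ `&` _ in PA2.
have HA2 : H r A2.
  by apply: (sigma_algebra_setI sH) => //; apply: GH; exact: measurable_wrt_le.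
pose bounded (n : nat) := [set w | forall q : rat, 0 <= (ratr q : R) < n1%:R + 1 ->
  `|B (ratr q) w| <= n%:R] `&` [set w | `|W r w| <= n%:R].
have Hbounded n : H r (bounded n).
  apply: (sigma_algebra_setI sH) => //.
    apply: GH; apply: sigma_algebra_countable_forall => // q /andP[q0 _].
    apply: measurable_wrt_normr_le => //.
    by apply: (measurable_wrtS BG); exact: whole_measurable_wrt.
  by apply: measurable_wrt_normr_le => //; exact: enlarged_past_measurable_wrt.
have [n2 PA3] : exists n2 : nat, (0 < P (A2 `&` bounded n2))%E.
  apply: probability_gt0_exists => //; [exact: mH|by move=> n; exact: mH|].
  apply: filterS goodP => w [[cB cW _ _] _] _.
  have [j hj] := continuous_segment_bounded (n1%:R + 1) cB.
  have [l hl] := continuous_segment_bounded r cW.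
  exists (j + l)%N; split => [q /andP[q0 qn]|] /=; rewrite natrD.
    by rewrite (le_trans (hj _ q0 (ltW qn)))// lerDl.
  by rewrite (le_trans (hl _ r0 (lexx _)))// lerDr.
pose c := k * (beta * Num.sqrt (1 - rho ^+ 2)).
have c0 : c != 0 by rewrite mulf_neq0.
(* The three products bound the drift term, the [B] term and the [W r] term of [k * Y]. *)
pose x := - K - (`|k * alpha| * n1%:R + `|k * beta * rho| * n2%:R + `|c| * n2%:R).
have rr1 : r < r1 by rewrite ltrDl.
have M0 : 0 < n1%:R + 1 :> R by rewrite ltr_wpDl.
have HA3 : H r (A2 `&` bounded n2) by exact: (sigma_algebra_setI sH).
have [E [mE PE hE]] := brownian_sweep BW sG mG GW x r0 rr1 M0 c0 HA3 PA3.
exists (A2 `&` bounded n2 `&` E); split => //.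
- by move=> w [[[[]]]].
- by apply: measurableI => //; exact: mH.
apply: filterS3 goodP hE (deltaT p0 eta0) => w gw hEw dw.
move=> [[[[_ /andP[mCp _]] CN] [Bn Wn]] Ew] s ps sN.
have [[cB cW _ _] [_ _ _ bJw]] := gw.
have Cs0 := C_ge0 s gw.
have Cs1 : C s w <= n1%:R by rewrite (le_trans (C_le gw sN)).
have Cr1 : r1 <= C s w.
  rewrite (le_trans _ (C_le gw ps))//.
  have pe : p <= p + eta by rewrite lerDl ltW.
  have := bJw _ _ (T_ge0 p gw) (T_le gw pe); rewrite -/(C _ _) -/(C _ _).
  have : b * delta eta <= b * (T (p + eta) w - T p w) by rewrite ler_pM2l.
  rewrite /r1 /r -natr1 mulrDl mul1r; move: mCp; rewrite /step; lra.
have Cr1M : C s w <= r1 + (n1%:R + 1).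
  by rewrite (le_trans Cs1)// ler_wpDl ?lerDl// (le_trans r0)// ltW.
have h1 := hEw Ew _ Cr1 Cr1M.
have h2 : `|B (C s w) w| <= n2%:R.
  by apply: (segment_le cB Bn) => //; rewrite (le_lt_trans Cs1)// ltrDl.
have h3 : k * alpha * C s w <= `|k * alpha| * n1%:R.
  by rewrite (le_trans (ler_norm _))// normrM (ger0_norm Cs0) ler_wpM2l.
have h4 : k * beta * rho * B (C s w) w <= `|k * beta * rho| * n2%:R.
  by rewrite (le_trans (ler_norm _))// normrM ler_wpM2l.
have h5 : c * W r w <= `|c| * n2%:R.
  by rewrite (le_trans (ler_norm _))// normrM ler_wpM2l.
rewrite (_ : k * Y s w = k * alpha * C s w + k * beta * rho * B (C s w) w +
   c * (W (C s w) w - W r w) + c * W r w); last by rewrite /Y /c; ring.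
by move: h1; rewrite /x; lra.
Qed.

End model.

(** * Simple strategies with a waiting time *)

Section trading_against_a_sweeping_process.
Context {d : measure_display} {Omega : measurableType d} {R : realType}.
Variables (P : probability Omega R) (F : R -> set (set Omega)) (Y : R -> Omega -> R).
Hypothesis sF : forall t, sigma_algebra setT (F t).
Hypothesis mF : forall t, 0 <= t -> F t `<=` measurable.
Hypothesis ndF : forall s t, 0 <= s -> s <= t -> F s `<=` F t.
Hypothesis aY : adapted F Y.
Hypothesis cY : {ae P, forall w t, 0 <= t -> right_continuous_at (Y^~ w) t}.
Hypothesis bY : forall N, {ae P, forall w, exists n : nat,
  forall t, 0 <= t -> t <= N -> `|Y t w| <= n%:R}.
Hypothesis sweepY : forall q eta K N k A, 0 <= q -> 0 < eta -> k != 0 ->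
  F q A -> (0 < P A)%E ->
  exists A' : set Omega, [/\ A' `<=` A, measurable A', (0 < P A')%E &
    {ae P, forall w, A' w -> forall s, q + eta <= s -> s <= N -> k * Y s w < - K}].

Let cell (tau : Omega -> R) (h : R) (i : nat) : set Omega :=
  [set w | tau w <= i%:R * h] `\` [set w | tau w <= i%:R * h - h].

Let cell_field tau h i : 0 < h -> (forall w, 0 <= tau w) -> stopping_time F tau ->
  F (i%:R * h) (cell tau h i).
Proof.
move=> h0 tau0 st; have ih : 0 <= i%:R * h by rewrite mulr_ge0// ltW.
apply: (sigma_algebra_setD (sF _)); first exact: st.
case: i ih => [|i] ih.
  (* The cell of index 0 would refer to the negative time [- h], but [tau] is nonnegative and the
     removed set is empty. *)
  rewrite (_ : [set w | _] = set0); first by case: (sF (0%:R * h)).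
  by apply/seteqP; split => w //=; have := tau0 w; lra.
have ih' : 0 <= i%:R * h by rewrite mulr_ge0// ltW.
rewrite -natr1 mulrDl mul1r addrK; apply: (ndF ih'); last exact: st.
by rewrite lerDl ltW.
Qed.

Let cell_cover tau h w : 0 < h -> 0 <= tau w -> exists i, cell tau h i w.
Proof.
move=> h0 tau0; have ex : exists i, tau w <= i%:R * h.
  exists (Num.truncn (tau w / h)).+1; rewrite -ler_pdivrMr//.
  exact: ltW (truncnS_gt _).
case: (ex_minnP ex) => i hi mi; exists i; split => //=.
case: i mi hi => [|i] mi hi; first by lra.
rewrite -natr1 mulrDl mul1r addrK => /mi; by rewrite ltnn.
Qed.

Let cellP tau h i w : cell tau h i w -> i%:R * h - h < tau w <= i%:R * h.
Proof. by move=> [/= -> /negP]; rewrite -ltNge => ->. Qed.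

(** [A] is cut along the cells of [tau]. Taking for [q] the right end of a cell makes the piece an
    event of [F q], by definition of the stopped field. *)
Lemma stopped_event_locate tau h A : 0 < h -> (forall w, 0 <= tau w) ->
  stopping_time F tau -> stopped_field F tau A -> (0 < P A)%E ->
  exists q A', [/\ 0 <= q, A' `<=` A, F q A', (0 < P A')%E &
    forall w, A' w -> q - h <= tau w <= q].
Proof.
move=> h0 tau0 st [mA FA] PA.
have i0 i : 0 <= i%:R * h by rewrite mulr_ge0// ltW.
have [||i PAi] := @probability_gt0_exists _ _ _ P nat A (cell tau h) mA _ _ PA.
- by move=> i; apply: mF (i0 i) _ _; exact: cell_field.
- by apply: aeW => w _; exact: cell_cover.
exists (i%:R * h), (A `&` cell tau h i); split => //.
- rewrite (_ : A `&` _ = (A `&` [set w | tau w <= i%:R * h]) `&` cell tau h i).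
    by apply: (sigma_algebra_setI (sF _)); [exact: FA|exact: cell_field].
  by apply/seteqP; split => w; [move=> [Aw [/= ? ?]]|move=> [[]]].
- by move=> w [_ /cellP /andP[/ltW -> ->]].
Qed.

(* Neither [Y (sig w) w] nor [Y (tau w) w] is ever used as a random variable:
   both are compared with deterministic bounds on Y over rational times, so that
   the resulting event stays in a field F q' at a deterministic time. *)
Lemma trade_sweep (sig tau : Omega -> R) h N q k A : 0 < h -> k != 0 ->
  (forall w, 0 <= sig w) -> (forall w, 0 <= tau w) -> (forall w, tau w <= N) ->
  stopping_time F tau -> {ae P, forall w, h <= tau w - sig w} ->
  0 <= q -> F q A -> (0 < P A)%E ->
  {ae P, forall w, A w -> q - h / 4 <= sig w <= q} ->
  exists q' A', [/\ 0 <= q', F q' A', (0 < P A')%E, A' `<=` A &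
    {ae P, forall w, A' w -> q' - h / 4 <= tau w <= q' /\
      k * Y (tau w) w < k * Y (sig w) w}].
Proof.
move=> h0 k0 sig0 tau0 tauN st hst q0 FA PA Asig.
have h80 : 0 < h / 8 by rewrite divr_gt0.
(* On [A], [sig <= q] and [tau >= q + 3h/4]. Hence [q1] leaves rational times after [sig], and the
   sweep, in force from [q1 + h / 4 = q + h / 2], is complete before [tau]. *)
pose q1 := q + h / 4; have q10 : 0 <= q1 by rewrite /q1; lra.
have qq1 : q <= q1 by rewrite /q1; lra.
pose Bd (n : nat) := [set w | forall u : rat, 0 <= (ratr u : R) < q1 ->
  `|Y (ratr u) w| <= n%:R].
have FBd n : F q1 (Bd n).
  apply: sigma_algebra_countable_forall => // u /andP[u0 uq].
  apply: measurable_wrt_normr_le => //; apply: measurable_wrtS (aY u0).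
  by apply: ndF => //; exact: ltW.
have [||n PA1] := @probability_gt0_exists _ _ _ P nat A Bd (mF q0 FA) _ _ PA.
- by move=> n; apply: mF (FBd n).
- apply: filterS (bY q1) => w [n hn] _; exists n => u /andP[u0 uq].
  by apply: hn => //; exact: ltW.
have FA1 : F q1 (A `&` Bd n).
  by apply: (sigma_algebra_setI (sF _)) => //; exact: ndF FA.
(* Since [k * Y] is at least [- |k| n] at [sig], the extra 1 makes the comparison strict. *)
pose K := `|k| * n%:R + 1.
have h40 : 0 < h / 4 by rewrite divr_gt0.
have [A2 [A21 mA2 PA2 hA2]] := sweepY K (N + h) q10 h40 k0 FA1 PA1.
have i0 i : 0 <= i%:R * (h / 8) by rewrite mulr_ge0// ltW.
have Fcell i : F (i%:R * (h / 8)) (cell tau (h / 8) i) by exact: cell_field.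
have [||i PA3] := @probability_gt0_exists _ _ _ P nat A2 (cell tau (h / 8)) mA2 _ _ PA2.
- by move=> i; apply: mF (Fcell i).
- by apply: aeW => w _; exact: cell_cover.
(* On the cell, [tau] lies in [(q2 - h / 8, q2]], hence within [h / 4] before [q']; the last [h / 8]
   leaves rational times between [tau] and [q']. These times stay below [N + h], the horizon of the
   sweep. *)
pose q2 := i%:R * (h / 8); pose q' := q2 + h / 8.
have mA3 : measurable (A2 `&` cell tau (h / 8) i).
  by apply: measurableI => //; exact: mF (Fcell i).
have aux : {ae P, forall w, A w -> q - h / 4 <= sig w <= q /\ h <= tau w - sig w}.
  by apply: filterS2 Asig hst => w Aw hw /Aw.
(* A deterministic inequality, read off at a single sample point of an event of positive
   probability. *)
have q1q' : q1 <= q'.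
  have [w [A2w /cellP wi] hw] := probability_gt0_witness mA3 PA3 aux.
  have [Aw _] := A21 _ A2w; have [/andP[? ?] ?] := hw Aw.
  by move: wi => /andP[? ?]; rewrite /q1 /q' /q2; lra.
have q'0 : 0 <= q' by exact: le_trans q1q'.
have q2q' : q2 <= q' by rewrite /q'; lra.
pose low := [set w | forall u : rat, q1 + h / 4 <= (ratr u : R) < q' ->
  k * Y (ratr u) w <= - K].
have Flow : F q' low.
  apply: sigma_algebra_countable_forall => // u /andP[u0 uq].
  have u0' : 0 <= ratr u :> R by apply: le_trans u0; lra.
  apply: (@measurable_wrt_le _ _ _ _ (fun w => k * Y (ratr u) w)).
  apply: measurable_wrtM => //; apply: measurable_wrtS (aY u0').
  by apply: ndF => //; exact: ltW.
exists q', (A `&` Bd n `&` cell tau (h / 8) i `&` low).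
have FA' : F q' (A `&` Bd n `&` cell tau (h / 8) i `&` low).
  apply: (sigma_algebra_setI (sF _)) => //; apply: (sigma_algebra_setI (sF _)).
    exact: ndF FA1.
  exact: ndF (Fcell i).
split => //.
(* [A2] need not belong to [F q']. The chosen event does, and it almost surely contains the part of
   [A2] in the cell. *)
- apply: probability_gt0_ae PA3 => //; first exact: mF FA'.
  apply: filterS hA2 => w hw [A2w ci]; split; first by split => //; exact: A21.
  move=> u /andP[u1 u2]; apply/ltW/(hw A2w) => //.
  move: ci => /cellP /andP[? ?]; have := tauN w; move: u2; rewrite /q' /q2; lra.
- by move=> w [[[]]].
apply: filterS2 aux cY => w aw cw [[[Aw Bw] /cellP /andP[ci1 ci2]] loww].
have [/andP[s1 s2] s3] := aw Aw.
split; first by apply/andP; rewrite /q' /q2; split; lra.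
have sq : sig w < q1 by rewrite /q1; lra.
have Ysig : `|Y (sig w) w| <= n%:R.
  have rc := cw _ (sig0 w); rewrite ler_norml; apply/andP; split.
    rewrite lerNl -mulN1r.
    apply: (right_continuous_le_rat (a := 0) (b := q1) (right_continuous_atM (-1) rc)) => //.
    by move=> u /Bw; rewrite mulN1r => /ler_normlP[].
  by apply: (right_continuous_le_rat (a := 0) (b := q1) rc) => // u /Bw /ler_normlP[].
have Ytau : k * Y (tau w) w <= - K.
  apply: (right_continuous_le_rat (a := q1 + h / 4) (b := q')
    (right_continuous_atM k (cw _ (tau0 w)))) => //.
    by rewrite /q1; lra.
  by rewrite /q' /q2; lra.
have : - (k * Y (sig w) w) <= `|k| * n%:R.
  by rewrite (le_trans (ler_norm _))// normrN normrM ler_wpM2l.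
by move: Ytau; rewrite /K; lra.
Qed.

Variables (S0 theta : R).
Hypothesis S00 : 0 < S0.
Let S t w := S0 * expR (theta * Y t w).

Let gain (H : strategy) (m : nat) w := \sum_(1 <= j < m)
  st_pos H j w * (S (st_time H j.+1 w) w - S (st_time H j w) w).

Section strategy.
Variables (H : strategy (Omega := Omega) (R := R)) (h : R).
Hypothesis h0 : 0 < h.
Hypothesis theta0 : theta != 0.
Hypothesis HH : simple_strategy_wait P F h H.
Hypothesis gain0 : {ae P, forall w, 0 <= terminal_gain H S w}.
Let n := st_size H.

Let time_ge0 j w : (1 <= j <= n)%N -> 0 <= st_time H j w.
Proof.
have [[_ t10 tle _ _] _] := HH.
elim: j => [//|[|j] IH] /andP[_ jn]; first exact: t10.
have jn' : (1 <= j.+1 < n)%N by rewrite jn.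
by rewrite (le_trans (IH _))//; [exact: ltnW|exact: tle].
Qed.

Let time_bounded : exists N, forall j w, (1 <= j <= n)%N -> st_time H j w <= N.
Proof.
have [[n2 _ tle _ [[N hN] _]] _] := HH; exists N => j w /andP[j1 jn].
apply: le_trans (hN w); rewrite -/n -(subnKC jn); set m := (n - j)%N.
have : (j + m <= n)%N by rewrite subnKC.
elim: m => [|m IH] jm; first by rewrite addn0.
rewrite addnS in jm *; rewrite (le_trans (IH (ltnW jm)))// tle//.
by rewrite (leq_trans j1) ?leq_addr.
Qed.

(* The [m]-th trade starts within h/4 before the deterministic time q. *)
Let losing (m : nat) := exists q A, [/\ 0 <= q, F q A, (0 < P A)%E &
  {ae P, forall w, A w -> q - h / 4 <= st_time H m w <= q /\ gain H m w < 0}].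

(** Monotonicity of the exponential. The boolean [e] encodes the sign of the position, and
    [(-1) ^+ e * theta] is the direction in which [Y] has to be swept. *)
Let S_sign (e : bool) s t w : (-1) ^+ e * theta * Y t w < (-1) ^+ e * theta * Y s w ->
  (-1) ^+ e * (S t w - S s w) < 0.
Proof.
rewrite /S -mulrBr mulrCA pmulr_rlt0//.
by case: e; rewrite ?expr0 ?expr1 ?mul1r ?mulN1r ?mulNr ?oppr_lt0 ?subr_gt0 ?subr_lt0
  ?ltrN2 ltr_expR.
Qed.

Let sign_theta (e : bool) : (-1) ^+ e * theta != 0.
Proof. by rewrite mulf_neq0// signr_eq0. Qed.

Let gainS m w : (1 <= m)%N -> gain H m.+1 w = gain H m w +
  st_pos H m w * (S (st_time H m.+1 w) w - S (st_time H m w) w).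
Proof. by move=> m1; rewrite /gain big_nat_recr. Qed.

Let wait j : (1 <= j < n)%N ->
  {ae P, forall w, h <= st_time H j.+1 w - st_time H j w}.
Proof. by move=> jn; have [_ hw] := HH; apply: filterS hw => w; exact. Qed.

(** On a subevent of positive probability the position of trade [m] has a constant weak sign.
    Sweeping against it makes this trade contribute at most 0, so the gain stays negative. *)
Let losingS m : (1 <= m < n)%N -> losing m -> losing m.+1.
Proof.
move=> /andP[m1 mn] [q [A [q0 FA PA hA]]].
have [[_ _ _ st [_ pos]] _] := HH; have [N hN] := time_bounded.
have mn1 : (1 <= m < n)%N by rewrite m1.
have mle : (1 <= m <= n)%N by rewrite m1 ltnW.
have mle1 : (1 <= m.+1 <= n)%N by [].
(* The sign of the position is known only at the stopping time; intersecting with [[tau_m <= q]]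
   brings it into [F q]. *)
pose E (e : bool) := [set w | 0 <= (-1) ^+ e * st_pos H m w] `&` [set w | st_time H m w <= q].
have FE e : F q (E e).
  have /(pos m mn1)[_ +] : measurable ((fun x => (-1) ^+ e * x) @^-1` `[0, +oo[ : set R).
    by rewrite -[X in measurable X]setTI; apply: measurable_funM.
  move=> /(_ q q0); rewrite (_ : _ `&` _ = E e)//.
  by apply/seteqP; split => w; rewrite /E/= in_itv/= andbT.
have [||e PAE] := @probability_gt0_exists _ _ _ P bool A E (mF q0 FA) _ _ PA.
- by move=> e; apply: mF (FE e).
- apply: filterS hA => w /[apply] -[/andP[_ tq] _].
  have [g0|g0] := leP 0 (st_pos H m w); [exists false|exists true]; split => //=.
    by rewrite mul1r.
  by rewrite mulN1r oppr_ge0 ltW.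
have FAE : F q (A `&` E e) by exact: (sigma_algebra_setI (sF q)).
have [|||||q' [A' [q'0 FA' PA' A'A hA']]] := trade_sweep (sig := st_time H m)
  (tau := st_time H m.+1) (N := N) h0 (sign_theta e) _ _ _ _ (wait mn1) q0 FAE PAE _.
- by move=> w; exact: time_ge0.
- by move=> w; exact: time_ge0.
- by move=> w; exact: hN.
- exact: st.
- by apply: filterS hA => w hw [/hw[]].
exists q', A'; split => //; apply: filterS2 hA hA' => w hw hw' A'w.
have [t1 /S_sign dS] := hw' A'w; have [Aw [/= g0 _]] := A'A _ A'w.
have [_ gw] := hw Aw; split => //; rewrite gainS//.
rewrite (le_lt_trans _ gw)// gerDl.
move: dS g0; case: (e); rewrite ?expr0 ?expr1 ?mul1r ?mulN1r ?oppr_ge0 ?oppr_lt0 => dS g0.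
  by rewrite mulr_le0_ge0// ltW.
by rewrite mulr_ge0_le0// ltW.
Qed.

Let losing_absurd m : (1 <= m <= n)%N -> ~ losing m.
Proof.
move=> /andP[m1 mn] lm.
have : losing n.
  rewrite -(subnKC mn); set k := (n - m)%N; have : (m + k <= n)%N by rewrite subnKC.
  elim: k => [|k IH] km; first by rewrite addn0.
  rewrite addnS in km *; apply: losingS (IH (ltnW km)).
  by rewrite km (leq_trans m1) ?leq_addr.
move=> [q [A [q0 FA PA hA]]].
have [w Aw [gw lw]] := probability_gt0_witness (mF q0 FA) PA (filterI gain0 hA).
by have [_] := lw Aw; rewrite ltNge /gain -/(terminal_gain H S w) gw.
Qed.

(** Strong induction: earlier positions vanish, so the gain before trade [j] is zero. A nonzero
    position would allow a strictly losing trade, hence [losing j.+1]. *)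
Lemma nonnegative_gain_position_eq0 j : (1 <= j < n)%N ->
  {ae P, forall w, st_pos H j w = 0}.
Proof.
have [[_ _ _ st [_ pos]] _] := HH; have [N hN] := time_bounded.
elim/ltn_ind: j => j IH /andP[j1 jn]; have jn1 : (1 <= j < n)%N by rewrite j1.
have jle : (1 <= j <= n)%N by rewrite j1 ltnW.
have jle1 : (1 <= j.+1 <= n)%N by [].
have gj0 : {ae P, forall w, gain H j w = 0}.
  have : {ae P, forall w i, (1 <= i < j)%N -> st_pos H i w = 0}.
    apply: ae_foralln => i; have [ij|ij] := boolP (1 <= i < j)%N; last exact: aeW.
    have /andP[i1 ij'] := ij; apply: filterS (IH i ij' _) => //.
    by rewrite i1 (ltn_trans ij').
  by apply: filterS => w hw; rewrite /gain big_nat big1// => i /hw ->; rewrite mul0r.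
pose E (e : bool) := [set w | 0 < (-1) ^+ e * st_pos H j w].
have FE e : stopped_field F (st_time H j) (E e).
  have /(pos j jn1) : measurable ((fun x => (-1) ^+ e * x) @^-1` `]0, +oo[ : set R).
    by rewrite -[X in measurable X]setTI; apply: measurable_funM.
  rewrite (_ : _ @^-1` _ = E e)//.
  by apply/seteqP; split => w; rewrite /E/= in_itv/= andbT.
have mE e : measurable (E e) by have [] := FE e.
suff NE e : P (E e) = 0%E.
  have : P.-negligible (E false `|` E true).
    by apply: negligibleU; apply/negligibleP => //; exact: NE.
  apply: negligibleS => w /= /eqP; rewrite /E/= expr0 expr1 mul1r mulN1r oppr_gt0.
  by rewrite neq_lt => /orP[]; [right|left].
apply/eqP; rewrite eq_le measure_ge0 andbT leNgt; apply/negP => PE.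
have h40 : 0 < h / 4 by rewrite divr_gt0.
have tj0 w : 0 <= st_time H j w by exact: time_ge0.
(* The precision [h / 4] is the one that [trade_sweep] requires of the start of a trade. *)
have [q [A [q0 AE FA PA hA]]] := stopped_event_locate h40 tj0 (st _ jle) (FE e) PE.
apply: (losing_absurd jle1).
have [||||q' [A' [q'0 FA' PA' A'A hA']]] := trade_sweep (sig := st_time H j)
  (tau := st_time H j.+1) (N := N) h0 (sign_theta e) tj0 _ _ _ (wait jn1) q0 FA PA _.
- by move=> w; exact: time_ge0.
- by move=> w; exact: hN.
- exact: st.
- exact: aeW.
exists q', A'; split => //; apply: filterS2 gj0 hA' => w gw hw' A'w.
have [t1 /S_sign dS] := hw' A'w; have /AE g0 := A'A _ A'w; split => //.
rewrite gainS// gw add0r; move: dS g0; rewrite /E/=.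
case: (e); rewrite ?expr0 ?expr1 ?mul1r ?mulN1r ?oppr_gt0 ?oppr_lt0 => dS g0.
  by rewrite nmulr_rlt0.
by rewrite pmulr_rlt0.
Qed.

End strategy.

Lemma sweep_no_arbitrage : no_arbitrage P F (cheridito_class P F) S.
Proof.
have Fcst t (Q : Prop) : F t [set w | Q].
  have [q|q] := pselect Q.
    by rewrite (_ : [set _ | _] = setT) ?set_true//;
      [exact: sigma_algebra_setT|apply/seteqP; split].
  by rewrite (_ : [set _ | _] = set0); [case: (sF t)|apply/seteqP; split].
split.
  move=> t t0 A mA.
  rewrite (_ : S t @^-1` A = Y t @^-1` ((fun y => S0 * expR (theta * y)) @^-1` A))//.
  apply: aY => //; rewrite -[X in measurable X]setTI.
  have mf : measurable_fun setT (fun y : R => S0 * expR (theta * y)).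
    apply: measurable_funM => //.
    apply: (measurableT_comp (@measurable_expR R)).
    by apply: measurable_funM => //.
  exact: mf.
apply/seteqP; split => [x [[H [h /= h0 HH] xH] [mx x0]]|x [mx x0]]; last first.
  split; last by split => //; apply: filterS x0 => w ->.
  (* The null position held from time 0 to time 1 realises the zero gain, with waiting time 1. *)
  pose H0 := @Strategy _ Omega R 2 0 (fun _ _ => 0) (fun j _ => (1 < j)%N%:R).
  exists H0.
    exists 1; first exact: ltr01.
    split; last by apply: aeW => w [|[|j]]//= _; rewrite subr0.
    split => //=.
    - by move=> [|[|j]] w //=.
    - by move=> j _ t _; exact: Fcst.
    - split; first by exists 1.
      move=> j _ A mA; rewrite preimage_cst; case: ifPn => _; split => //.
      + by move=> t _; rewrite setTI; exact: Fcst.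
      + by move=> t _; rewrite set0I; case: (sF t).
  by apply: filterS x0 => w ->; rewrite /terminal_gain big_nat big1// => j _; rewrite mul0r.
(* For [theta = 0] the price is constant and all gains vanish, while the positions may be
   arbitrary. *)
split => //; have [theta0|theta0] := eqVneq theta 0.
  apply: filterS xH => w ->; rewrite /terminal_gain big1// => j _.
  by rewrite /S theta0 !mul0r subrr mulr0.
have g0 : {ae P, forall w, 0 <= terminal_gain H S w}.
  by apply: filterS2 xH x0 => w ->.
have : {ae P, forall w j, (1 <= j < st_size H)%N -> st_pos H j w = 0}.
  apply: ae_foralln => j; have [jn|jn] := boolP (1 <= j < st_size H)%N; last exact: aeW.
  by apply: filterS (nonnegative_gain_position_eq0 h0 theta0 HH g0 jn).
apply: filterS2 xH => w -> hw.
by rewrite /terminal_gain big_nat big1// => j /hw ->; rewrite mul0r.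
Qed.

End trading_against_a_sweeping_process.

(** * The augmented filtration and the conclusion *)

Section augmentation.
Context {d : measure_display} {Omega : measurableType d} {R : realType}.
Variables (P : probability Omega R) (Xs : set (R -> Omega -> R)).

Lemma augmentation_sigma_algebra t : sigma_algebra setT (augmentation P Xs t).
Proof. by apply: sigma_algebra_bigcap => u _; exact: g_sigma_algebraP. Qed.

Lemma augmentationS s t : s <= t -> augmentation P Xs s `<=` augmentation P Xs t.
Proof. by move=> st A As u /= tu; apply: As => /=; exact: le_lt_trans tu. Qed.

Lemma augmentation_measurable t : P.-negligible `<=` measurable ->
  (forall X s, Xs X -> measurable_wrt measurable (X s)) ->
  augmentation P Xs t `<=` measurable.
Proof.
move=> mN mX A /(_ (t + 1)) /=; rewrite ltrDl ltr01 => /(_ isT).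
apply: g_sigma_algebra_subset; first exact: sigma_algebra_measurable.
move=> A' [|/mN//]; apply: sigma_rv_subset; first exact: sigma_algebra_measurable.
by move=> _ [X XX [s _ <-]]; exact: mX.
Qed.

Lemma augmentation_adapted X : Xs X -> adapted (augmentation P Xs) X.
Proof.
move=> XX t t0 A mA u /= tu; apply: sub_sigma_algebra; left.
by apply: past_measurable_wrt => //; exact: ltW.
Qed.

End augmentation.

Theorem theorem4p7 (d : measure_display) (Omega : measurableType d)
    (R : realType) (P : probability Omega R) (F : R -> set (set Omega))
    (B W J : R -> Omega -> R) (rho alpha beta theta S0 : R)
    (mu sigma : R -> R -> R) (v : R -> Omega -> R) (delta : R -> R)
    (Z := fun t w => rho * B t w + Num.sqrt (1 - rho ^+ 2) * W t w)
    (T := time_change v)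
    (X := fun t w => alpha * J t w + beta * Z (J t w) w)
    (Y := fun t w => X (T t w) w)
    (S := fun t w => S0 * expR (theta * Y t w)) :
  usual_conditions P F ->
  brownian_motion P B -> adapted F B ->
  brownian_motion P W -> adapted F W ->
  independent P (whole [set B]) (whole [set W]) ->
  levy_process P J -> adapted F J -> nondecreasing_paths P J ->
  independent P (whole [set J]) (whole [set B; W]) ->
  -1 <= rho <= 1 ->
  unique_strong_solution P mu sigma 1 B v ->
  {ae P, forall w t, 0 <= t -> 0 <= v t w} ->
  (forall t, 0 <= t -> 'E_P[T t]%E = t%:E) ->
  {ae P, forall w, T t w @[t --> +oo] --> +oo} ->
  0 < S0 ->
  beta != 0 ->
  `|rho| != 1 ->
  nonzero_continuous_part P J ->
  delta 0 = 0 ->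
  (forall h, 0 < h -> 0 < delta h) ->
  (forall h k, 0 <= h -> h <= k -> delta h <= delta k) ->
  (forall t0 h, 0 < t0 -> 0 < h ->
     {ae P, forall w, delta h <= T (t0 + h) w - T t0 w}) ->
  let FYT := augmentation P [set Y; T] in
  no_arbitrage P FYT (cheridito_class P FYT) S.
Proof.
move=> usual BB _ BW _ iBW levyJ _ ndJ iJ rho1 [[av cv _ _ _] _] v0 _ _ S00 beta0
  rhoN1 [b [L [b0 levyL pureL JL]]] _ delta0 _ deltaT FYT.
have mN : P.-negligible `<=` measurable.
  have [[sF _] _ NF] := usual; have [_ mF] := sF 0 (lexx 0).
  exact: subset_trans NF mF.
have [mJ _ _ _ cadlagJ] := levyJ; have [_ _ _ _ cadlagL] := levyL.
have cJ : {ae P, forall w t, 0 <= t -> right_continuous_at (J^~ w) t}.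
  apply: filterS cadlagJ => w [rc _] t t0.
  by apply: cvg_right_continuous_at; exact: rc.
have pathJ : {ae P, forall w, [/\ 0 <= b, J 0 w = 0 &
    forall s t, 0 <= s -> s <= t -> b * (t - s) <= J t w - J s w]}.
  near=> w.
  have nd : forall s t, 0 <= s -> s <= t -> J s w <= J t w by near: w; exact: ndJ.
  have [_ lL] : (forall t, 0 <= t -> L u w @[u --> t^'+] --> L t w) /\
    (forall t, 0 < t -> cvg (L u w @[u --> t^'-])) by near: w; exact: cadlagL.
  have JLw : forall t, 0 <= t -> J t w = b * t + L t w by near: w; exact: JL.
  have Lw : forall t, 0 <= t ->
    (L t w)%:E = \esum_(s in `]0, t]) (jump L s w)%:E by near: w; exact: pureL.
  split.
  - exact: (@drift_ge0 _ (J^~ w) (L^~ w) b).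
  - exact: (@subordinator_path0 _ (J^~ w) (L^~ w) b).
  - exact: (@drift_increment _ (J^~ w) (L^~ w) b).
have b_gt0 : 0 < b.
  have PT : (0 < P setT)%E by rewrite probability_setT lte_fin.
  (* The drift is deterministic, so one good sample point determines its sign. *)
  have [w _ [b_ge0 _ _]] := probability_gt0_witness measurableT PT pathJ.
  by rewrite lt_neqAle eq_sym b0.
have J0 : {ae P, forall w, J 0 w = 0} by apply: filterS pathJ => w [].
have bJ : {ae P, forall w s t, 0 <= s -> s <= t -> b * (t - s) <= J t w - J s w}.
  by apply: filterS pathJ => w [].
have W0 : beta * Num.sqrt (1 - rho ^+ 2) != 0.
  rewrite mulf_neq0// gt_eqF// sqrtr_gt0 subr_gt0 -real_normK ?num_real//.
  by rewrite expr_lt1// lt_neqAle rhoN1 ler_norml.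
have mY t : measurable_wrt measurable (Y t).
  exact: (log_price_measurable alpha beta rho mN BB BW mJ av cv v0 cJ J0 ndJ bJ).
have mT t : measurable_wrt measurable (T t).
  exact: (time_change_measurable mN BB mJ av cv v0).
have mFYT t : FYT t `<=` measurable.
  by apply: augmentation_measurable => // _ s [->|->].
apply: sweep_no_arbitrage => //.
- exact: augmentation_sigma_algebra.
- by move=> s t _; exact: augmentationS.
- by apply: augmentation_adapted; left.
- exact: (log_price_right_continuous alpha beta rho BB BW cv v0 cJ J0 ndJ bJ).
- exact: (log_price_bounded alpha beta rho BB BW cv v0 cJ J0 ndJ bJ).
- move=> q eta K N k A q0 eta0 k0 FA PA.
  (* Half of [eta] is spent on passing from the right-continuous field at [q] to the generated one
     at [p = q + eta / 2]. It also makes [p] positive, as the bound on the increments of [T]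
     requires; the other half is the delay of the sweep. *)
  have e20 : 0 < eta / 2 by rewrite divr_gt0.
  have p0 : 0 < q + eta / 2 by rewrite ltr_wpDl.
  have pA : <<s past [set Y; T] (q + eta / 2) `|` P.-negligible >> A.
    by apply: FA; rewrite /= ltrDl.
  have [A' [A'A mA' PA' hA']] := log_price_sweep mN BB BW iBW mJ iJ av cv v0 cJ J0 ndJ
    b_gt0 bJ delta0 deltaT W0 K N p0 e20 k0 pA PA.
  exists A'; split => //; apply: filterS hA' => w hw /hw h s; rewrite -addrA -splitr in h.
  exact: h.
Unshelve. all: by end_near. Qed.
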